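(* Let $K_n=(V,E)$ be the complete graph on $n$ vertices, let $(\omega_e)_{e\in E}$ be i.i.d. uniform random variables on $[0,1]$, and let $\mathcal{O}(\beta)$ be the expected edge overlap of two independent samples of the random spanning tree in random environment on $K_n$ with parameter $\beta=\beta(n)$ (in the same environment $\omega$). (i) If $0<\beta=\beta(n)\ll n/\log n$, then with high probability $$\mathcal{O}(\beta)=\big(1+o_\beta(1)\big)\,\beta\,\frac{1-e^{-2\beta}}{(1-e^{-\beta})^2}.$$ (ii) If $\beta=\beta(n)\gg n(\log n)^2$, then with high probability $$\mathcal{O}(\beta)=\big(1-o_\beta(1)\big)\,n.$$
   Context: Random spanning tree in random environment (RSTRE): $K_n=(V,E)$ is the complete graph on $V=\{1,\dots,n\}$; $\omega=(\omega_e)_{e\in E}$ are i.i.d. uniform on $[0,1]$ under a probability measure $\mathbb{P}$ with expectation $\mathbb{E}$. For $\beta\ge 0$ put $\mathrm{w}(e)=\exp(-\beta\omega_e)$. Given $\omega$, the quenched law on the set $\mathbb{T}(K_n)$ of spanning trees of $K_n$ (trees are identified with their edge sets) is $$\mathbf{P}^\omega_{n,\beta}(\mathcal{T}=T)=\frac{1}{Z^\omega_\beta}\prod_{e\in T}\mathrm{w}(e),$$ with $Z_\beta^\omega$ the normalizing constant; its expectation is $\mathbf{E}^\omega_{n,\beta}$. The averaged law is $\widehat{\mathbb{P}}(\cdot)=\mathbb{E}[\mathbf{P}^\omega_{n,\beta}(\cdot)]$. Edge overlap: for $\mathcal{T},\mathcal{T}'$ sampled independently from $\mathbf{P}^\omega_{n,\beta}$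 (same $\omega$), $$\mathcal{O}(\beta)=\sum_{T,T'\in\mathbb{T}(K_n)}|T\cap T'|\,\mathbf{P}^\omega_{n,\beta}(\mathcal{T}=T)\,\mathbf{P}^\omega_{n,\beta}(\mathcal{T}=T').$$ This is a random variable depending on $\omega$. Asymptotic notation ($n\to\infty$): $f\ll g$ means $f(n)/g(n)\to0$; $f\gg g$ means $g(n)/f(n)\to 0$. An event holds with high probability if its $\widehat{\mathbb{P}}$-probability tends to $1$ as $n\to\infty$ (for events depending only on $\omega$ this is its $\mathbb{P}$-probability). The statement ''$X_n=(1\pm o_\beta(1))f$ with high probability'' means that there are functions $h_1,h_2:\mathbb{R}\times\mathbb{N}\to[0,\infty)$ with $h_1(\beta(n),n)\to0$ and $h_2(\beta(n),n)\to0$ whenever $\beta(n)$ satisfies the stated growth condition, such that $\widehat{\mathbb{P}}(|X_n-f|\ge h_1(\beta(n),n)\,f)\le h_2(\beta(n),n)$. *)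

(* Defs.v *)
From HB Require Import structures.
From mathcomp Require Import all_boot all_order all_algebra.
From mathcomp Require Import all_classical all_reals all_analysis.

Set Implicit Arguments.
Unset Strict Implicit.
Unset Printing Implicit Defensive.

Import Order.TTheory GRing.Theory Num.Theory.
Import numFieldNormedType.Exports.

Local Open Scope classical_set_scope.
Local Open Scope ring_scope.

Definition edge (n : nat) : finType := {e : {set 'I_n} | #|e| == 2%N}.

(* Edges have exactly two endpoints, so [adj T] is irreflexive. *)
Definition adj (n : nat) (T : {set edge n}) : rel 'I_n :=
  fun x y => [exists e in T, val e == [set x; y]%SET].

Definition connected_graph (n : nat) (T : {set edge n}) : Prop :=
  forall x y : 'I_n, connect (adj T) x y.

(* [ucycle] also accepts closed walks of length 0 and 2 (an edge travelled back
   and forth), which are not graph cycles; hence the bound on the length. *)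
Definition acyclic_graph (n : nat) (T : {set edge n}) : Prop :=
  forall c : seq 'I_n, (2 < size c)%N -> ~ ucycle (adj T) c.

Definition spanning_tree (n : nat) (T : {set edge n}) : Prop :=
  connected_graph T /\ acyclic_graph T.

Section RSTRE.
Context {R : realType} {n : nat}.
Variables (beta : R) (x : edge n -> R).

Definition weight (e : edge n) : R := expR (- (beta * x e)).

Definition partition_function : R :=
  \sum_(T : {set edge n} | `[< spanning_tree T >]) \prod_(e in T) weight e.

Definition quenched_law (T : {set edge n}) : R :=
  (\prod_(e in T) weight e) / partition_function.

Definition edge_overlap : R :=
  \sum_(T : {set edge n} | `[< spanning_tree T >])
    \sum_(T' : {set edge n} | `[< spanning_tree T' >])
      #|T :&: T'|%:R * quenched_law T * quenched_law T'.

End RSTRE.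

Definition mutually_independent (d : measure_display) (Omega : measurableType d)
    (R : realType) (P : probability Omega R) (I : finType)
    (X : I -> {RV P >-> R}) : Prop :=
  forall (J : {set I}) (B : I -> set R), (forall i, measurable (B i)) ->
    P (\bigcap_(i in [set` J]) (X i @^-1` B i))
    = (\prod_(i in J) P (X i @^-1` B i))%E.

Definition iid_uniform01 (d : measure_display) (Omega : measurableType d)
    (R : realType) (P : probability Omega R) (I : finType)
    (X : I -> {RV P >-> R}) : Prop :=
  mutually_independent X /\
  forall (i : I) (B : set R), measurable B ->
    distribution P (X i) B = uniform_prob (@ltr01 R) B.

(* [f] is negligible compared with [g]. As division by zero is total, [g] is
   explicitly required to be eventually nonzero. *)
Definition much_less (R : realType) (f g : nat -> R) : Prop :=
  (\forall n \near \oo, g n != 0) /\ (fun n => f n / g n) @ \oo --> (0 : R).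

(* With high probability [X n (beta n)] is [f n (beta n)] up to a factor
   [1 + o_beta(1)] of either sign, when [beta] ranges over the sequences
   satisfying [growth]; the error functions do not depend on the sequence. *)
Definition whp_asymptotic (R : realType) (d : nat -> measure_display)
    (Omega : forall n, measurableType (d n))
    (P : forall n, probability (Omega n) R)
    (growth : (nat -> R) -> Prop)
    (X : forall n, R -> Omega n -> R) (f : nat -> R -> R) : Prop :=
  exists h1 h2 : R -> nat -> R,
    [/\ forall b n, 0 <= h1 b n,
        forall b n, 0 <= h2 b n &
        forall beta : nat -> R, growth beta ->
          [/\ (fun n => h1 (beta n) n) @ \oo --> (0 : R),
              (fun n => h2 (beta n) n) @ \oo --> (0 : R) &
              forall n : nat,
                (P n [set w | (h1 (beta n) n * f n (beta n)
                               <= `|X n (beta n) w - f n (beta n)|)%R]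
                 <= (h2 (beta n) n)%:E)%E]].

(* Main.v *)
Require Import Defs.
From HB Require Import structures.
From mathcomp Require Import all_boot all_order all_algebra.
From mathcomp Require Import all_classical all_reals all_analysis.
From mathcomp Require Import measurable_realfun.
From mathcomp Require Import ring lra.

(** Write [p e] for the probability that the random tree contains [e]. The overlap
    is the sum of the squares [p e ^+ 2], while the sum of the [p e] is [n - 1],
    the number of edges of a tree.

    For large [beta] it suffices that the sum of [p e * (1 - p e)] is [o(n)]. Given
    the other weights, [p e] is the logistic function [w e / (w e + C)] of
    [- beta * omega e], whose derivative in [omega e] is
    [- beta * p e * (1 - p e)]. Integrating over [omega e] in the unit interval
    gives mean at most [1 / beta] ([integral_edge_prob_variance]), so the deficit
    [n - overlap] has mean at most [1 + n ^+ 2 / beta], and Markov's inequality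
    concludes ([overlap_low_temperature]).

    For small [beta], Kirchhoff's theorem ([edge_prob_potential]) says that
    [p e = w e * r e] with [r e] the effective resistance between the ends of [e].
    Let [m1] and [m2] be the first two moments of a weight. The mean degree
    [n * m1] is large compared with [ln n], so by Chernoff bounds all degrees are
    at most [(1 + eps) * (n * m1)], and Dirichlet's principle gives
    [r e >= (1 - o(1)) * 2 / (n * m1)] for all edges ([potential_drop_lower]). The
    matching upper bound only has to hold on average, and there it is automatic:
    as the [p e] sum to [n - 1], which is what the lower bounds already give to
    leading order, the total excess is [o(n)]. Therefore a uniform bound
    [r e <= C / (n * m1)] with any constant [C] makes the contribution of the excess
    to the sum of squares negligible ([sum_edge_prob_sqr_bounds]). Such a bound
    follows from Cheeger's inequality ([cheeger], [potential_drop_upper]), since by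
    Chernoff bounds and a union bound every set of [s <= n / 2] vertices has a
    boundary of weight at least [s * n * m1 / 4]. The overlap is thus close to
    [(2 / (n * m1)) ^+ 2] times the sum of the [w e ^+ 2], which concentrates at
    [n ^+ 2 / 2 * m2]; this gives [2 * m2 / m1 ^+ 2]
    ([overlap_high_temperature]).

    The law of large numbers used here and the averaging over a single weight both
    rest on [integral_indep]: one variable can be integrated out before any
    function of the others. *)

Set Implicit Arguments.
Unset Strict Implicit.
Unset Printing Implicit Defensive.

Import Order.TTheory GRing.Theory Num.Theory.
Import numFieldNormedType.Exports.

Local Open Scope classical_set_scope.
Local Open Scope ring_scope.

(** * Edges and connectivity *)

Definition joins (n : nat) (e : edge n) (x y : 'I_n) : bool :=
  val e == [set x; y]%SET.

Section Edges.
Variable n : nat.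
Implicit Types (e f : edge n) (x y z u v : 'I_n) (T : {set edge n}).

Lemma joinsC e x y : joins e x y = joins e y x.
Proof. by rewrite /joins finset.setUC. Qed.

Lemma joins_neq e x y : joins e x y -> x != y.
Proof.
move=> /eqP exy; have := valP e; rewrite exy cards2.
by case: (x != y).
Qed.

Lemma joins_inj e f x y : joins e x y -> joins f x y -> e = f.
Proof. by move=> /eqP ex /eqP fx; apply: val_inj; rewrite ex fx. Qed.

Lemma edge_joins e : exists x y, joins e x y.
Proof.
have /cards2P[x [y [_ exy]]] : #|val e| == 2%N by exact: valP e.
by exists x, y; rewrite /joins exy.
Qed.

Lemma joins_exists x y : x != y -> exists e, joins e x y.
Proof.
move=> xy; have c2 : #|[set x; y]%SET| == 2%N by rewrite cards2 xy.
by exists (Sub [set x; y]%SET c2); rewrite /joins SubK.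
Qed.

Lemma joins_eq e x y a b : joins e x y -> joins e a b ->
  (a = x /\ b = y) \/ (a = y /\ b = x).
Proof.
move=> exy eab; have ab := joins_neq eab; have xy := joins_neq exy.
have {exy eab} E : [set x; y]%SET = [set a; b]%SET.
  by rewrite -(eqP exy) (eqP eab).
have : a \in [set x; y]%SET by rewrite E !inE eqxx.
have : b \in [set x; y]%SET by rewrite E !inE eqxx orbT.
rewrite !inE => /orP[]/eqP bE /orP[]/eqP aE; rewrite aE bE in ab *.
- by rewrite eqxx in ab.
- by right.
- by left.
- by rewrite eqxx in ab.
Qed.

(** Undirected edges correspond to two ordered pairs of endpoints; this is how
    sums over vertex pairs become sums over edges. *)
Lemma big_joins (V : Type) (idx : V) (op : Monoid.com_law idx) e u v
    (F : 'I_n -> 'I_n -> V) : joins e u v ->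
  \big[op/idx]_x \big[op/idx]_(y | joins e x y) F x y = op (F u v) (F v u).
Proof.
move=> euv; have uv := joins_neq euv; have evu := euv; rewrite joinsC in evu.
rewrite (bigD1 u)//= [X in op _ X](bigD1 v) 1?eq_sym//=.
rewrite [X in op _ (op _ X)]big1 ?Monoid.mulm1; last first.
  move=> x /andP[xu xv]; rewrite big_pred0// => y; apply/negbTE/negP => exy.
  by case: (joins_eq euv exy) => -[xE _]; rewrite xE eqxx in xu xv.
have H (a b : 'I_n) : joins e a b -> \big[op/idx]_(y | joins e a y) F a y = F a b.
  move=> eab; rewrite (big_pred1 b) // => y /=; apply/idP/eqP => [eay|-> //].
  case: (joins_eq eab eay) => -[] // aE yE.
  by have := joins_neq eab; rewrite aE eqxx.
by rewrite !(H _ _ euv) (H _ _ evu).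
Qed.

Lemma big_pairs (V : Type) (idx : V) (op : Monoid.com_law idx) (P : pred (edge n))
    (F : edge n -> 'I_n -> 'I_n -> V) :
  \big[op/idx]_x \big[op/idx]_y \big[op/idx]_(e | P e && joins e x y) F e x y =
  \big[op/idx]_(e | P e) \big[op/idx]_x \big[op/idx]_(y | joins e x y) F e x y.
Proof.
rewrite [RHS]exchange_big; apply: eq_bigr => x _.
rewrite (exchange_big_dep P) => [|y e _ /andP[]//]; apply: eq_bigr => e Pe.
by apply: eq_bigl => y; rewrite Pe.
Qed.

Lemma adjP T x y : reflect (exists2 e, e \in T & joins e x y) (adj T x y).
Proof. exact: exists_inP. Qed.

Lemma adjC T x y : adj T x y = adj T y x.
Proof.
by apply/adjP/adjP => -[e eT exy]; exists e => //; rewrite joinsC.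
Qed.

Lemma connectC T x y : connect (adj T) x y = connect (adj T) y x.
Proof. by apply: sym_connect_sym => a b; exact: adjC. Qed.

Lemma adjS T T' x y : T \subset T' -> adj T x y -> adj T' x y.
Proof. by move=> /fintype.subsetP TT' /adjP[e /TT' eT' exy]; apply/adjP; exists e. Qed.

Lemma connectS T T' x y :
  T \subset T' -> connect (adj T) x y -> connect (adj T') x y.
Proof.
move=> TT'; apply: connect_sub => a b /(adjS TT'); exact: connect1.
Qed.

Lemma adjD1 T e x y : adj T x y -> ~~ joins e x y -> adj (T :\ e) x y.
Proof.
move=> /adjP[f fT fxy] nexy; apply/adjP; exists f => //.
by rewrite !inE fT andbT; apply: contraNneq nexy => <-.
Qed.

(** Deleting one edge splits a component into at most the two components of its
    endpoints. *)
Lemma connectD1 T e x y z : joins e x y -> connect (adj T) z x ->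
  connect (adj (T :\ e)) z x || connect (adj (T :\ e)) z y.
Proof.
move=> exy; rewrite connectC => xz.
pose A := [pred t | connect (adj (T :\ e)) t x || connect (adj (T :\ e)) t y].
suff cA : closed_mem (adj T) (mem A).
  have := closed_connect cA xz; rewrite [x \in A]inE connect0 /= => /esym.
  by rewrite inE.
apply: intro_closed => [|a b ab]; first by apply: sym_connect_sym => ? ?; exact: adjC.
rewrite !inE; case: (boolP (joins e a b)) => [eab|neab] H.
  case: (joins_eq exy eab) => -[_ ->]; first by rewrite connect0 orbT.
  by rewrite connect0.
have ba : connect (adj (T :\ e)) b a.
  by apply: connect1; rewrite adjC; exact: adjD1.
by case/orP: H => H; rewrite (connect_trans ba H) ?orbT.
Qed.

End Edges.

(** * Spanning trees *)

Section Trees.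
Variable n : nat.
Implicit Types (e f : edge n) (x y z u v : 'I_n) (T : {set edge n}).

Definition conn T := [forall x, forall y, connect (adj T) x y].

(** Spanning trees as minimal connected graphs: this boolean form lets trees
    index finite sums, and bridges are what the exchange arguments use. *)
Definition tree T := conn T && [forall e in T, ~~ conn (T :\ e)].

Lemma connP T : reflect (forall x y, connect (adj T) x y) (conn T).
Proof.
apply: (iffP forallP) => H x; last by apply/forallP => y; exact: H.
by move=> y; have /forallP := H x; apply.
Qed.

Lemma tree_connect T x y : tree T -> connect (adj T) x y.
Proof. by move=> /andP[/connP]. Qed.

Lemma conn_bridge T e x y : joins e x y -> conn T ->
  conn (T :\ e) = connect (adj (T :\ e)) x y.
Proof.
move=> exy /connP cT; apply/connP/idP => [|xy]; first exact.
have zx z : connect (adj (T :\ e)) z x.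
  have /orP[//|zy] := connectD1 exy (cT z x).
  by apply: connect_trans zy _; rewrite connectC.
by move=> a b; apply: connect_trans (zx a) _; rewrite connectC.
Qed.

Lemma tree_bridge T e x y : tree T -> e \in T -> joins e x y ->
  connect (adj (T :\ e)) x y = false.
Proof.
move=> /andP[cT /forall_inP bT] eT exy; apply/negbTE.
by rewrite -(conn_bridge exy cT); exact: bT.
Qed.

Lemma tree_side T e x y z : tree T -> e \in T -> joins e x y ->
  connect (adj (T :\ e)) y z = ~~ connect (adj (T :\ e)) x z.
Proof.
move=> tT eT exy; have xy := tree_bridge tT eT exy.
have := connectD1 exy (tree_connect z x tT); rewrite ![connect _ z _]connectC.
case: (boolP (connect _ x z)) => //= xz _.
apply/negbTE; apply: contraFN xy => yz; apply: connect_trans xz _.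
by rewrite connectC.
Qed.

(** An edge lies on no cycle if and only if deleting it separates its ends. *)
Lemma spanning_treeE T : `[< spanning_tree T >] = tree T.
Proof.
apply/asboolP/idP => [[cT aT]|tT].
  apply/andP; split; first exact/connP.
  apply/forall_inP => e eT; have [x [y exy]] := edge_joins e.
  rewrite (conn_bridge exy); last exact/connP.
  apply/negP => /connectP[p0 p0P yE].
  move: yE; have [p pP pu _] := shortenP p0P => yE {p0 p0P}.
  have xy : adj T x y by apply/adjP; exists e.
  have pP' : path (adj T) x p.
    by apply: sub_path pP => a b; apply: adjS; exact: subD1set.
  (* the detour around [e], closed up by [e], is a cycle of length at least 3 *)
  apply: (aT (x :: p)).
    case: p yE pP pu {pP'} => [|a [|b p]] //= yE.
      by move: (joins_neq exy); rewrite yE eqxx.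
    rewrite andbT -yE => /adjP[f]; rewrite !inE => /andP[fe _] fxy.
    by move: fe; rewrite (joins_inj fxy exy) eqxx.
  by rewrite /ucycle pu andbT /cycle rcons_path pP' /= -yE adjC.
split=> [x y|c c2 /andP[cc uc]]; first exact: tree_connect.
case: c c2 cc uc => [|x [|y [|z s]]] // _.
rewrite /cycle rcons_path [path _ _ _]/= => /andP[/and3P[axy ayz azs] alast].
rewrite 3!cons_uniq !inE !negb_or => /and4P[/and3P[xy xz xs] /andP[yz ys] zs us].
have /adjP[e eT exy] := axy.
suff : connect (adj (T :\ e)) y x.
  by rewrite connectC (tree_bridge tT eT exy).
have nj a b : a != x -> b != x -> ~~ joins e a b.
  move=> ax bx; apply/negP => eab.
  by case: (joins_eq exy eab) => -[aE bE]; rewrite ?aE ?bE eqxx in ax bx.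
(* conversely, a cycle through [e] provides a detour around [e] *)
have yp : path (adj (T :\ e)) y (z :: s).
  rewrite /= adjD1 //=; last by apply: nj; rewrite eq_sym.
  have xzs : x \notin z :: s by rewrite inE negb_or xz.
  elim: s z {xz yz zs ys us alast ayz} azs xs xzs => //= b s IH z /andP[zb bs].
  rewrite !inE !negb_or => /andP[xb xs] /and3P[xz _ _].
  rewrite adjD1 //=; last by apply: nj; rewrite eq_sym.
  by apply: IH => //; rewrite inE negb_or xb.
apply: (@connect_trans _ _ (last z s)).
  by apply/connectP; exists (z :: s).
apply: connect1; rewrite adjD1 //; apply/negP => el.
have yl : y \notin z :: s by rewrite inE negb_or yz.
have ml : last z s \in z :: s by exact: mem_last.
case: (joins_eq exy el) => -[lE bE]; first by rewrite bE eqxx in xy.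
by rewrite -lE ml in yl.
Qed.

(** The only neighbour [y] of [x] that can be counted is the next vertex on the
    path from [x] to [u]; this replaces any explicit handling of paths in trees
    below. *)
Lemma tree_next T x u : tree T ->
  (\sum_y \sum_(e in T | joins e x y) connect (adj (T :\ e)) y u)%N = (x != u).
Proof.
move=> tT; case: (eqVneq x u) => [<-|xu].
  apply: big1 => y _; apply: big1 => e /andP[eT exy].
  by rewrite connectC (tree_bridge tT eT exy).
have /connectP[p0 p0P uE] := tree_connect x u tT.
rewrite {}uE in xu *; move: xu; have [p pP pu _] := shortenP p0P => xu {u p0 p0P}.
case: p xu pP pu => [|y p]; first by rewrite eqxx.
move=> _ /= /andP[/adjP[e eT exy] yp] /andP[xp _].
have nx f a b : x != a -> x != b -> joins f a b -> ~~ joins f x a.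
  move=> xa xb fab; apply/negP => fxa; case: (joins_eq fab fxa) => -[] E _.
    by rewrite E eqxx in xa.
  by rewrite E eqxx in xb.
have yu f z : joins f x z -> connect (adj (T :\ f)) y (last y p).
  move=> fxz; apply/connectP; exists p => //.
  elim: p y yp xp {exy} => //= b p IH a /andP[ab bp].
  rewrite !inE !negb_or => /and3P[xa xb xp].
  rewrite IH ?inE ?negb_or ?xb//= andbT; apply: adjD1 => //.
  apply/negP => fab; case: (joins_eq fab fxz) => -[E _].
    by rewrite E eqxx in xa.
  by rewrite E eqxx in xb.
rewrite (bigD1 y)//= (bigD1 e)/=; last by rewrite eT exy.
rewrite (yu _ _ exy) big1 ?addn0; last first.
  by move=> f /andP[/andP[_ fxy]]; rewrite (joins_inj fxy exy) eqxx.
rewrite big1 ?addn0// => z zy; apply: big1 => f /andP[fT fxz].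
suff -> : connect (adj (T :\ f)) z (last y p) = false by [].
apply/negbTE; have := tree_side (last y p) tT fT fxz => ->; rewrite negbK.
apply: connect_trans (yu _ _ fxz); apply: connect1; apply/adjP; exists e => //.
rewrite !inE eT andbT; apply: contraNneq zy => ef; rewrite -ef in fxz.
case: (joins_eq exy fxz) => -[] E1 E2; first by rewrite E2.
by move: (joins_neq exy); rewrite E1 eqxx.
Qed.

(** Orienting each edge of a tree towards [u] pairs the edges with the vertices
    other than [u]. *)
Lemma tree_card T u : tree T -> #|T|.+1 = n.
Proof.
move=> tT.
have : (\sum_x \sum_y \sum_(e in T | joins e x y)
    connect (adj (T :\ e)) y u)%N = n.-1.
  under eq_bigr do rewrite tree_next//.
  rewrite -big_mkcond /= sum1_card (eq_card (B := predC1 u)) //.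
  by rewrite cardC1 card_ord.
have -> : (\sum_x \sum_y \sum_(e in T | joins e x y)
    connect (adj (T :\ e)) y u)%N = #|T|.
  rewrite -sum1_card (big_pairs _ (mem T) (fun e x y => connect (adj (T :\ e)) y u : nat)).
  apply: eq_bigr => e eT; have [x [y exy]] := edge_joins e.
  rewrite (big_joins _ (fun x y => connect (adj (T :\ e)) y u : nat) exy).
  by rewrite (tree_side _ tT eT exy); case: (connect _ x u).
by move=> ->; rewrite prednK //; exact: leq_ltn_trans (ltn_ord u).
Qed.

(** A connected graph with the right number of edges is a tree, since it
    contains a minimal connected one, which already has that many edges. *)
Lemma conn_card_tree T : conn T -> (#|T| < n)%N -> tree T.
Proof.
move=> cT Tn; have [T0 /minsetP[cT0 minT0] T0T] := minset_exists cT.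
have tT0 : tree T0.
  apply/andP; split=> //; apply/forall_inP => e eT; apply/negP => /minT0.
  by move=> /(_ (subD1set _ _)) E; move: eT; rewrite -E !inE eqxx.
suff <- : T0 = T by [].
apply/eqP; rewrite eqEcard T0T /= -ltnS.
by rewrite (tree_card (Ordinal (leq_ltn_trans (leq0n _) Tn)) tT0).
Qed.

Lemma tree_exists : exists T, tree T.
Proof.
have cT : conn [set: edge n]%SET.
  apply/connP => x y; case: (eqVneq x y) => [->//|/joins_exists[e exy]].
  by apply: connect1; apply/adjP; exists e; rewrite ?inE.
have [T0 /minsetP[cT0 minT0] _] := minset_exists cT.
exists T0; apply/andP; split=> //; apply/forall_inP => e eT; apply/negP => /minT0.
by move=> /(_ (subD1set _ _)) E; move: eT; rewrite -E !inE eqxx.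
Qed.

(** Edge exchange: replacing [e] by an edge [f] which joins the two sides of
    the cut that [e] defines. *)
Lemma tree_exchange T e f u v x y : tree T -> e \in T ->
  joins e u v -> joins f x y ->
  connect (adj (T :\ e)) u x -> connect (adj (T :\ e)) v y ->
  [/\ f \notin T :\ e, tree (f |: T :\ e) & (f |: T :\ e) :\ f = T :\ e].
Proof.
move=> tT eT euv fxy ux vy.
have fT : f \notin T :\ e.
  apply/negP => fT; have /negP := negbT (tree_bridge tT eT euv); apply.
  apply: connect_trans ux _; apply: connect_trans (connect1 _) _.
    by apply/adjP; exists f; [exact: fT | exact: fxy].
  by rewrite connectC.
split; [exact: fT | | by rewrite setU1K].
apply: conn_card_tree; last first.
  by have := tree_card u tT; rewrite cardsU1 fT add1n (cardsD1 e) eT => /eq_leq.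
have sub a b : connect (adj (T :\ e)) a b -> connect (adj (f |: T :\ e)) a b.
  by apply: connectS; exact: finset.subsetUr.
have uz z : connect (adj (f |: T :\ e)) u z.
  case: (boolP (connect (adj (T :\ e)) u z)) => [/sub//|].
  rewrite -(tree_side _ tT eT euv) => /sub vz.
  apply: connect_trans (sub _ _ ux) _; apply: (@connect_trans _ _ y).
    by apply: connect1; apply/adjP; exists f; rewrite ?inE ?eqxx.
  by apply: connect_trans vz; rewrite connectC sub.
by apply/connP => a b; apply: connect_trans (uz b); rewrite connectC.
Qed.

End Trees.

(** * Kirchhoff's theorem on edge probabilities *)

Section Kirchhoff.
Context {R : realFieldType} {n : nat}.
Variable w : edge n -> R.
Hypothesis w_gt0 : forall e, 0 < w e.
Implicit Types (e f : edge n) (x y z u v : 'I_n) (T : {set edge n}).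

Definition tree_weight T : R := \prod_(e in T) w e.

Definition tree_sum : R := \sum_(T | tree T) tree_weight T.

Definition edge_prob e : R :=
  (\sum_(T | tree T && (e \in T)) tree_weight T) / tree_sum.

(** Edge weights as a symmetric matrix with zero diagonal. *)
Definition conductance x y : R := \sum_(e | joins e x y) w e.

Definition degree x : R := \sum_y conductance x y.

Lemma tree_weight_gt0 T : 0 < tree_weight T.
Proof. by apply: prodr_gt0 => e _. Qed.

Lemma tree_sum_gt0 : 0 < tree_sum.
Proof.
have [T tT] := tree_exists n; rewrite /tree_sum (bigD1 T)//=.
by apply: ltr_pwDl (tree_weight_gt0 T) _; apply: sumr_ge0 => T' _; exact/ltW/tree_weight_gt0.
Qed.

Lemma conductanceC x y : conductance x y = conductance y x.
Proof. by apply: eq_bigl => e; rewrite joinsC. Qed.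

Lemma conductance_ge0 x y : 0 <= conductance x y.
Proof. by apply: sumr_ge0 => e _; exact: ltW. Qed.

Lemma conductanceE e x y : joins e x y -> conductance x y = w e.
Proof.
move=> exy; rewrite /conductance (big_pred1 e)// => f /=.
by apply/idP/eqP => [fxy|-> //]; exact: joins_inj fxy exy.
Qed.

Lemma sum_conductance (F : 'I_n -> 'I_n -> R) :
  \sum_x \sum_y conductance x y * F x y =
  \sum_e w e * (\sum_x \sum_(y | joins e x y) F x y).
Proof.
under eq_bigr do under eq_bigr do rewrite mulr_suml.
rewrite (big_pairs _ xpredT (fun e x y => w e * F x y)).
apply: eq_bigr => e _; rewrite mulr_sumr; apply: eq_bigr => x _.
by rewrite mulr_sumr.
Qed.

Lemma sum_edge_prob : (0 < n)%N -> \sum_e edge_prob e = n.-1%:R.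
Proof.
move=> n0; rewrite -mulr_suml.
apply: (canLR (mulfK _)); first by rewrite gt_eqF ?tree_sum_gt0.
rewrite /tree_sum mulr_sumr.
rewrite (exchange_big_dep (@tree n)) => [|e T _ /andP[]//]; apply: eq_bigr => T tT.
rewrite (eq_bigl (mem T)) => [|e]; last by rewrite tT.
have := tree_card (Ordinal n0) tT => /(congr1 predn) /= <-.
by rewrite sumr_const mulr_natl.
Qed.

(** Up to the factor [tree_sum], this is the potential of a unit current from [u]
    to the other endpoint [v] of [e]. It is Kirchhoff's formula in terms of the
    spanning forests with two components that separate [u] from [v]: these are
    the sets [T :\ e]. *)
Definition forest_potential e u x : R :=
  \sum_(T | tree T && (e \in T))
    tree_weight (T :\ e) * (connect (adj (T :\ e)) u x)%:R.

Lemma tree_weightD1 T e : e \in T -> tree_weight T = w e * tree_weight (T :\ e).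
Proof. by move=> eT; rewrite /tree_weight (big_setD1 e). Qed.

Definition separating_weight e u v x y : R :=
  \sum_(T | tree T && (e \in T))
    tree_weight (T :\ e) *
    (connect (adj (T :\ e)) u x && connect (adj (T :\ e)) v y)%:R.

(** Exchanging [e] for [f] is a bijection from the trees whose cut along [e] is
    crossed by [f] to those whose cut along [f] is crossed by [e], and both trees
    leave the same forest. *)
Lemma separating_weight_exchange e f u v x y : joins e u v -> joins f x y ->
  separating_weight e u v x y = separating_weight f x y u v.
Proof.
move=> euv fxy; rewrite /separating_weight.
pose side e u v x y T := connect (adj (T :\ e)) u x && connect (adj (T :\ e)) v y.
have cond g a b c d : \sum_(T | tree T && (g \in T))
    tree_weight (T :\ g) * (connect (adj (T :\ g)) a c && connect (adj (T :\ g)) b d)%:R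
  = \sum_(T | (tree T && (g \in T)) && side g a b c d T) tree_weight (T :\ g).
  by rewrite [RHS]big_mkcondr; apply: eq_bigr => T _; rewrite /side; case: ifP; rewrite ?mulr1 ?mulr0.
rewrite !cond (reindex_onto (fun T => e |: T :\ f) (fun T => f |: T :\ e)) /=; last first.
  move=> T /andP[/andP[tT eT] /andP[ux vy]].
  have [fT tT' ->] := tree_exchange tT eT euv fxy ux vy.
  by rewrite finset.setD1K.
apply: eq_big => [T|T].
  apply/idP/idP.
    move=> /andP[/andP[/andP[t' _] s] /eqP E].
    have [ux vy] := andP s.
    have e' : e \in e |: T :\ f by rewrite !inE eqxx.
    have [] := tree_exchange t' e' euv fxy ux vy; rewrite E => fN tT TE.
    have fT : f \in T by rewrite -E !inE eqxx.
    by rewrite tT fT /side TE !(connectC _ x) !(connectC _ y) ux vy.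
  move=> /andP[/andP[tT fT] /andP[xu yv]].
  have [eN tT' E] := tree_exchange tT fT fxy euv xu yv.
  rewrite E finset.setD1K // tT' !inE eqxx /= /side E eqxx andbT.
  by rewrite !(connectC _ _ x) !(connectC _ _ y) xu yv.
move=> /andP[/andP[/andP[t' _] s] /eqP E].
have [ux vy] := andP s.
have e' : e \in e |: T :\ f by rewrite !inE eqxx.
have [] := tree_exchange t' e' euv fxy ux vy; rewrite E => fN tT TE.
exact: congr1 (esym TE).
Qed.

(** The current through [f] is the expected number of signed crossings of [f] by
    the tree path from [u] to [v]: after the exchange, the side of [f] on which
    [u] and [v] lie tells whether and in which direction the path uses [f]. *)
Lemma forest_potentialB e f u v x y : joins e u v -> joins f x y ->
  w f * (forest_potential e u x - forest_potential e u y) =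
  \sum_(T | tree T && (f \in T))
    tree_weight T * ((connect (adj (T :\ f)) y v)%:R - (connect (adj (T :\ f)) y u)%:R).
Proof.
move=> euv fxy.
have -> : forest_potential e u x - forest_potential e u y =
    separating_weight e u v x y - separating_weight e u v y x.
  rewrite -!sumrB; apply: eq_bigr => T /andP[tT eT]; rewrite -!mulrBr; congr (_ * _).
  rewrite !(tree_side _ tT eT euv).
  by case: (connect _ u x); case: (connect _ u y); rewrite ?subr0 ?subrr.
rewrite (separating_weight_exchange euv fxy).
have fyx : joins f y x by rewrite joinsC.
rewrite (separating_weight_exchange euv fyx).
rewrite /separating_weight -sumrB mulr_sumr; apply: eq_bigr => T /andP[tT fT].
rewrite (tree_weightD1 fT) -mulrBr mulrA; congr (_ * _).
rewrite !(tree_side _ tT fT fxy).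
by case: (connect _ x u); case: (connect _ x v); rewrite ?subr0 ?subrr ?sub0r.
Qed.

(** Kirchhoff: the probability of [e] is its weight times the effective
    resistance [psi u - psi v] between its ends. The node law holds tree by tree,
    because by [tree_next] a path from [u] to [v] enters every other vertex as
    often as it leaves it. *)
Lemma edge_prob_potential e u v : joins e u v ->
  exists psi : 'I_n -> R,
    [/\ psi v = 0, edge_prob e = w e * psi u &
        forall x, \sum_y conductance x y * (psi x - psi y) = (x == u)%:R - (x == v)%:R].
Proof.
move=> euv; have Z0 := lt0r_neq0 tree_sum_gt0.
exists (fun x => forest_potential e u x / tree_sum); split.
- rewrite /forest_potential big1 ?mul0r// => T /andP[tT eT].
  by rewrite (tree_bridge tT eT euv) mulr0.
- rewrite mulrA; congr (_ / _); rewrite mulr_sumr; apply: eq_bigr => T /andP[_ eT].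
  by rewrite connect0 mulr1 -(tree_weightD1 eT).
move=> x; under eq_bigr do rewrite -mulrBl mulrA.
rewrite -mulr_suml; apply: (canLR (mulfK Z0)).
under eq_bigr => y _.
  rewrite mulr_suml; under eq_bigr => f fxy do rewrite (forest_potentialB euv fxy).
  over.
under eq_bigr do rewrite (exchange_big_dep (@tree n)) => [|? ? _ /andP[]//].
rewrite /= exchange_big mulr_sumr; apply: eq_bigr => T tT /=.
under eq_bigr do under eq_bigl do rewrite tT andTb.
under eq_bigr do rewrite -mulr_sumr sumrB.
rewrite -mulr_sumr sumrB mulrC; congr (_ * _).
have H t : \sum_y \sum_(f | joins f x y && (f \in T)) (connect (adj (T :\ f)) y t)%:R
    = (x != t)%:R :> R.
  rewrite -(tree_next x t tT) natr_sum; apply: eq_bigr => y _.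
  by rewrite natr_sum; apply: eq_bigl => f; rewrite andbC.
by rewrite !H; do 2 case: eqVneq => _ /=; rewrite ?subrr ?subr0 ?sub0r ?oppr0.
Qed.

End Kirchhoff.

Lemma edge_overlapE (R : realType) (n : nat) (beta : R) (x : edge n -> R) :
  edge_overlap beta x = \sum_e edge_prob (weight beta x) e ^+ 2.
Proof.
have qE T : quenched_law beta x T = tree_weight (weight beta x) T / tree_sum (weight beta x).
  by congr (_ / _); apply: eq_bigl => T'; rewrite spanning_treeE.
rewrite /edge_overlap (eq_bigl (@tree n)); last by move=> T; rewrite spanning_treeE.
under eq_bigr do under eq_bigl do rewrite spanning_treeE.
have -> : \sum_e edge_prob (weight beta x) e ^+ 2 =
    \sum_e \sum_(T | tree T) \sum_(T' | tree T') (e \in T :&: T')%SET%:R *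
      quenched_law beta x T * quenched_law beta x T'.
  apply: eq_bigr => e _; rewrite expr2 /edge_prob !mulr_suml.
  rewrite big_mkcondr; apply: eq_bigr => T _; rewrite mulr_sumr big_mkcondr /=.
  case: ifP => eT; last first.
    by rewrite big1// => T' _; rewrite inE eT !mul0r.
  apply: eq_bigr => T' _; rewrite inE eT /=; case: ifP => eT'.
    by rewrite mul1r !qE.
  by rewrite !mul0r.
rewrite [RHS]exchange_big; apply: eq_bigr => T _.
rewrite [RHS]exchange_big; apply: eq_bigr => T' _.
rewrite -!mulr_suml; congr (_ * _ * _).
by rewrite -natr_sum -big_mkcond sum1_card; congr _%:R; apply: eq_card => e; rewrite !inE.
Qed.

(** * Effective resistance and expansion *)

Section Network.
Context {R : realFieldType} {V : finType}.
Variable c : V -> V -> R.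
Hypothesis cC : forall x y, c x y = c y x.
Hypothesis c_ge0 : forall x y, 0 <= c x y.
Implicit Types f g h psi : V -> R.

(** Twice the Dirichlet form, as each edge is counted in both directions. *)
Definition energy f g : R := \sum_x \sum_y c x y * ((f x - f y) * (g x - g y)).

Definition cut (S : {set V}) : R := \sum_(x in S) \sum_(y in ~: S) c x y.

Lemma cutE (S : {set V}) :
  cut S = \sum_x \sum_y c x y * ((x \in S) && (y \notin S))%:R.
Proof.
rewrite /cut [LHS]big_mkcond; apply: eq_bigr => x _.
case: ifP => xS; last by rewrite big1// => y _; rewrite mulr0.
rewrite [LHS]big_mkcond; apply: eq_bigr => y _; rewrite finset.in_setC.
by case: ifP => yS; rewrite ?mulr1 ?mulr0.
Qed.

Lemma sum_swap (F : V -> V -> R) :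
  \sum_x \sum_y c x y * F x y = \sum_x \sum_y c x y * F y x.
Proof. by rewrite exchange_big; do 2 apply: eq_bigr => ? _; rewrite cC. Qed.

Lemma energy_green f g :
  energy f g = 2 * \sum_x f x * \sum_y c x y * (g x - g y).
Proof.
have -> : energy f g = (\sum_x \sum_y c x y * (f x * (g x - g y))) +
    (\sum_x \sum_y c x y * (f y * (g y - g x))).
  rewrite -big_split; apply: eq_bigr => x _; rewrite -big_split.
  by apply: eq_bigr => y _ /=; ring.
rewrite -(sum_swap (fun x y => f x * (g x - g y))) mulr2n mulrDl mul1r.
suff -> : \sum_x \sum_y c x y * (f x * (g x - g y)) =
  \sum_x f x * \sum_y c x y * (g x - g y) by [].
by apply: eq_bigr => x _; rewrite mulr_sumr; apply: eq_bigr => y _; rewrite mulrCA.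
Qed.

Lemma energy_ge0 f : 0 <= energy f f.
Proof. by do 2 apply: sumr_ge0 => ? _; rewrite mulr_ge0 // -expr2 sqr_ge0. Qed.

Section UnitCurrent.
Variables (u v : V) (psi : V -> R).
Hypothesis uv : u != v.
Hypothesis psi_flow :
  forall x, \sum_y c x y * (psi x - psi y) = (x == u)%:R - (x == v)%:R.

Lemma energy_unit_current f : energy f psi = 2 * (f u - f v).
Proof.
rewrite energy_green; congr (2 * _).
under eq_bigr do rewrite psi_flow mulrBr.
rewrite sumrB; congr (_ - _).
  rewrite (bigD1 u)//= eqxx mulr1 big1 ?addr0// => x /negbTE ->; exact: mulr0.
by rewrite (bigD1 v)//= eqxx mulr1 big1 ?addr0// => x /negbTE ->; exact: mulr0.
Qed.

Lemma potential_drop_ge0 : 0 <= psi u - psi v.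
Proof. by have := energy_ge0 psi; rewrite energy_unit_current pmulr_rge0. Qed.

(** Dirichlet's principle for the test function which is [1] at [u], [-1] at [v]
    and [0] elsewhere. When degrees are large compared with single conductances
    this loses nothing to leading order, unlike the bound [D^-1] from the
    current out of [u] alone. *)
Lemma potential_drop_lower (D : R) :
  (forall x, \sum_y c x y <= D) -> (forall x y, c x y <= 1) ->
  2 / (D + 1) <= psi u - psi v.
Proof.
move=> cD c1.
have D0 : 0 <= D by apply: le_trans (cD u); exact: sumr_ge0.
pose f x : R := (x == u)%:R - (x == v)%:R.
have fu : f u = 1 by rewrite /f eqxx (negbTE uv) subr0.
have fv : f v = -1 by rewrite /f eqxx eq_sym (negbTE uv) sub0r.
have sumE a b (F : V -> R) : \sum_x F x * ((x == a)%:R - (x == b)%:R) = F a - F b.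
  under eq_bigr do rewrite mulrBr.
  rewrite sumrB; congr (_ - _).
    rewrite (bigD1 a)//= eqxx mulr1 big1 ?addr0// => x /negbTE ->; exact: mulr0.
  by rewrite (bigD1 b)//= eqxx mulr1 big1 ?addr0// => x /negbTE ->; exact: mulr0.
have Ef : energy f f <= 4 * (D + 1).
  rewrite energy_green; under eq_bigr do rewrite mulrC.
  rewrite sumE fu fv.
  have lu : \sum_y c u y * (1 - f y) <= D + 1.
    under eq_bigr do rewrite mulrBr mulr1.
    rewrite sumrB sumE; have := cD u; have := c1 u v; have := c_ge0 u u; lra.
  have lv : - (\sum_y c v y * (-1 - f y)) <= D + 1.
    under eq_bigr do rewrite mulrBr mulrN1.
    rewrite sumrB sumE sumrN; have := cD v; have := c1 v u; have := c_ge0 v v; lra.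
  lra.
have D1 : 0 < D + 1 by rewrite ltr_wpDl.
pose s := (D + 1)^-1.
have : 0 <= energy (fun x => psi x - s * f x) (fun x => psi x - s * f x).
  exact: energy_ge0.
have -> : energy (fun x => psi x - s * f x) (fun x => psi x - s * f x) =
    energy psi psi - 2 * s * energy f psi + s ^+ 2 * energy f f.
  rewrite /energy !mulr_sumr -sumrB -big_split; apply: eq_bigr => x _ /=.
  rewrite !mulr_sumr -sumrB -big_split; apply: eq_bigr => y _ /=; ring.
rewrite !energy_unit_current fu fv => H.
have s0 : 0 < s by rewrite invr_gt0.
have : s ^+ 2 * energy f f <= 4 * s.
  apply: le_trans (ler_wpM2l (sqr_ge0 s) Ef) _.
  by rewrite mulrCA /s expr2 -mulrA mulVf ?mulr1 ?lt0r_neq0.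
rewrite -/s; lra.
Qed.

End UnitCurrent.

Section Cheeger.
Variables (k D : R).
Hypothesis k_gt0 : 0 < k.
Hypothesis degree_le : forall x, \sum_y c x y <= D.
Hypothesis expansion :
  forall S : {set V}, (2 * #|S| <= #|V|)%N -> k * #|S|%:R <= cut S.

Definition supp g : {set V} := [set x | (0 < g x)%R]%SET.

(** The co-area inequality, obtained by peeling off the lowest level of [g]. *)
Lemma coarea g : (forall x, 0 <= g x) -> (2 * #|supp g| <= #|V|)%N ->
  2 * (k * \sum_x g x) <= \sum_x \sum_y c x y * `|g x - g y|.
Proof.
move: {2}(#|_|) (leqnn #|supp g|) => m.
elim: m g => [|m IH] g gm g0 gV.
  have gE x : g x = 0.
    move: gm; rewrite leqn0 cards_eq0 => /eqP/setP/(_ x); rewrite !inE => /negbT.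
    by rewrite -leNgt => gx; apply/eqP; rewrite eq_le gx g0.
  rewrite big1 ?mulr0//.
  by do 2 apply: sumr_ge0 => ? _; rewrite mulr_ge0.
have [S0|/finset.set0Pn[x0 x0S]] := eqVneq (supp g) finset.set0.
  by apply: IH => //; rewrite S0 cards0.
set S := supp g in gm gV x0S.
pose xm := [arg min_(x < x0 in S) g x]%O.
have [xmS gmin] : xm \in S /\ forall y, y \in S -> g xm <= g y.
  by rewrite /xm; case: arg_minP.
pose a := g xm.
have a0 : 0 < a by move: xmS; rewrite inE.
pose g' x := if x \in S then g x - a else 0.
have gS x : x \notin S -> g x = 0.
  by rewrite inE -leNgt => gx; apply/eqP; rewrite eq_le gx g0.
have g'0 x : 0 <= g' x.
  by rewrite /g'; case: ifP => // xS; rewrite subr_ge0 gmin.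
have S'S : supp g' \subset S :\ xm.
  apply/fintype.subsetP => x; rewrite !inE /g'; case: ifP => [xS gx|]; last by rewrite ltxx.
  move: (xS); rewrite inE => ->; rewrite andbT; apply: contraTneq gx => ->.
  by rewrite subrr ltxx.
have cS' : (#|supp g'| < #|S|)%N.
  by rewrite [X in (_ < X)%N](cardsD1 xm) xmS ltnS subset_leq_card.
have {}IH := IH g' (leq_trans cS' gm) g'0
  (leq_trans (leq_mul (leqnn 2) (ltnW cS')) gV).
have -> : \sum_x g x = \sum_x g' x + a * #|S|%:R.
  rewrite -sum1_card natr_sum mulr_sumr [X in _ + X]big_mkcond -big_split.
  apply: eq_bigr => x _ /=; rewrite /g'; case: ifPn => xS; last by rewrite addr0 gS.
  by rewrite mulr1 subrK.
have -> : \sum_x \sum_y c x y * `|g x - g y| =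
    \sum_x \sum_y c x y * `|g' x - g' y| + 2 * a * cut S.
  have -> : 2 * a * cut S = a * cut S + a * cut S by ring.
  rewrite {1}cutE cutE [X in _ + (_ + a * X)]sum_swap !mulr_sumr -!big_split.
  apply: eq_bigr => x _ /=; rewrite !mulr_sumr -!big_split.
  apply: eq_bigr => y _ /=; rewrite /g'.
  case: (boolP (x \in S)) => xS; case: (boolP (y \in S)) => yS /=; rewrite ?mulr0n ?mulr1n.
  - rewrite !mulr0 !addr0; congr (_ * `|_|); ring.
  - rewrite (gS _ yS) !subr0 !ger0_norm ?subr_ge0 ?gmin//; ring.
  - rewrite (gS _ xS) !sub0r !normrN !ger0_norm ?subr_ge0 ?gmin//; ring.
  - by rewrite !gS// subrr !mulr0 !addr0.
have := ler_wpM2l (ltW a0) (expansion gV); rewrite -/S; lra.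
Qed.

(** Cheeger's inequality: apply [coarea] to the square of [h] and separate the two
    factors of [`|h x - h y| * (h x + h y)] by the inequality of means. *)
Lemma cheeger h : (forall x, 0 <= h x) -> (2 * #|supp h| <= #|V|)%N ->
  k ^+ 2 * \sum_x h x ^+ 2 <= D * energy h h.
Proof.
move=> h0 hV; have [x0 _|V0] := pickP V; last first.
  by rewrite /energy !big_pred0 ?mulr0// => x; have := V0 x.
have D0 : 0 <= D by apply: le_trans (degree_le x0); exact: sumr_ge0.
set Q := \sum_x h x ^+ 2.
have Q0 : 0 <= Q by apply: sumr_ge0 => x _; exact: sqr_ge0.
have hc : 2 * (k * Q) <= \sum_x \sum_y c x y * `|h x ^+ 2 - h y ^+ 2|.
  apply: coarea => [x|]; first exact: sqr_ge0.
  rewrite (_ : supp _ = supp h)//; apply/setP => x; rewrite !inE.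
  by rewrite !lt_def !h0 sqr_ge0 expf_eq0.
have [D_eq0|D_neq0] := eqVneq D 0.
  suff -> : Q = 0 by rewrite D_eq0 mulr0 mul0r.
  apply/eqP; rewrite eq_le Q0 andbT -(pmulr_rle0 _ k_gt0).
  have c0 x y : c x y = 0.
    apply/eqP; rewrite eq_le c_ge0 andbT -D_eq0; apply: le_trans (degree_le x).
    by rewrite (bigD1 y)//= lerDl sumr_ge0.
  move: hc; rewrite big1 => [|x _]; last by apply: big1 => y _; rewrite c0 mul0r.
  by lra.
have {D0} D_gt0 : 0 < D by rewrite lt_def D_neq0.
(* the weight in the inequality of means that balances the two terms *)
pose s := k / (2 * D).
have s0 : 0 < s by rewrite divr_gt0// mulr_gt0.
have : \sum_x \sum_y c x y * `|h x ^+ 2 - h y ^+ 2| <=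
    (2 * s)^-1 * energy h h + s / 2 * (4 * D * Q).
  have -> : (2 * s)^-1 * energy h h + s / 2 * (4 * D * Q) =
      (2 * s)^-1 * energy h h + s * (2 * \sum_x D * h x ^+ 2).
    by rewrite -mulr_sumr -/Q; field; rewrite lt0r_neq0.
  have hs : \sum_x \sum_y c x y * (h x ^+ 2 + h y ^+ 2) <= 2 * \sum_x D * h x ^+ 2.
    have -> : \sum_x \sum_y c x y * (h x ^+ 2 + h y ^+ 2) =
        2 * \sum_x \sum_y c x y * h x ^+ 2.
      rewrite mulr_natl mulr2n {2}(sum_swap (fun x _ => h x ^+ 2)) -big_split; apply: eq_bigr => x _ /=.
      by rewrite -big_split; apply: eq_bigr => y _ /=; rewrite mulrDr.
    rewrite ler_wpM2l//; apply: ler_sum => x _; rewrite -mulr_suml.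
    by rewrite ler_wpM2r// sqr_ge0.
  apply: le_trans (_ : _ <= (2 * s)^-1 * energy h h +
     s * \sum_x \sum_y c x y * (h x ^+ 2 + h y ^+ 2)) _; last by rewrite lerD2l ler_wpM2l// ltW.
  rewrite /energy !mulr_sumr -big_split; apply: ler_sum => x _ /=.
  rewrite !mulr_sumr -big_split; apply: ler_sum => y _ /=.
  rewrite [(2 * s)^-1 * _]mulrCA [s * _]mulrCA -mulrDr ler_wpM2l//.
  have -> : h x ^+ 2 - h y ^+ 2 = (h x - h y) * (h x + h y) by ring.
  rewrite normrM (ger0_norm (addr_ge0 (h0 x) (h0 y))) -[X in _ <= _ * X + _]expr2.
  rewrite -(real_normK (num_real (h x - h y))).
  set p := `|h x - h y|; set q := h x + h y.
  have : 0 <= (p - s * q) ^+ 2 by exact: sqr_ge0.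
  have : q ^+ 2 <= 2 * (h x ^+ 2 + h y ^+ 2).
    rewrite -subr_ge0 [X in 0 <= X](_ : _ = (h x - h y) ^+ 2) ?sqr_ge0// /q; ring.
  move=> /(ler_wpM2l (ltW s0)) /(ler_wpM2l (ltW s0)) q2 pq.
  rewrite -(ler_pM2l (mulr_gt0 (ltr0Sn R 1) s0)).
  have -> : 2 * s * ((2 * s)^-1 * p ^+ 2 + s * (h x ^+ 2 + h y ^+ 2)) =
      p ^+ 2 + s * (s * (2 * (h x ^+ 2 + h y ^+ 2))) by field; rewrite lt0r_neq0.
  nra.
move=> /(le_trans hc); have k0 := lt0r_neq0 k_gt0.
have -> : (2 * s)^-1 * energy h h = D / k * energy h h by rewrite /s; field; rewrite k0.
have -> : s / 2 * (4 * D * Q) = k * Q by rewrite /s; field.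
move=> H; have : k * Q <= D / k * energy h h by lra.
by move=> /(ler_wpM2l (ltW k_gt0)); rewrite !mulrA [k * D]mulrC mulfK.
Qed.

(** The least value of [psi] with at most half of the vertices above it. *)
Lemma median_exists psi : V -> exists m,
  (2 * #|[set x | (m < psi x)%R]%SET| <= #|V|)%N /\
  (2 * #|[set x | (psi x < m)%R]%SET| <= #|V|)%N.
Proof.
move=> z; pose P x := (2 * #|[set y | (psi x < psi y)%R]%SET| <= #|V|)%N.
pose t := [arg max_(x > z) psi x]%O.
have Pt : P t.
  rewrite /P (_ : [set y | _]%SET = finset.set0) ?cards0//.
  apply/setP => y; rewrite !inE; apply/negbTE; rewrite -leNgt /t.
  by case: arg_maxP => // i _ /(_ y); exact.
pose x0 := [arg min_(x < t | P x) psi x]%O.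
have [Px0 minx0] : P x0 /\ forall y, P y -> psi x0 <= psi y.
  by rewrite /x0; case: arg_minP.
exists (psi x0); split=> //.
have [->|/finset.set0Pn[y0]] := eqVneq [set x | (psi x < psi x0)%R]%SET finset.set0.
  by rewrite cards0 muln0.
rewrite inE => y0P.
pose y1 := [arg max_(x > y0 | psi x < psi x0) psi x]%O.
have [y1P maxy1] : psi y1 < psi x0 /\ forall y, psi y < psi x0 -> psi y <= psi y1.
  by rewrite /y1; case: arg_maxP.
have : ~~ P y1 by apply/negP => /minx0; rewrite leNgt y1P.
rewrite /P -ltnNge (_ : [set y | _]%SET = ~: [set x | (psi x < psi x0)%R]%SET); last first.
  apply/setP => y; rewrite !inE -leNgt; apply/idP/idP => [y1y|x0y].
    by rewrite leNgt; apply/negP => /maxy1; rewrite leNgt y1y.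
  exact: lt_le_trans y1P x0y.
have := cardsC [set x | (psi x < psi x0)%R]%SET.
set A := #|_|; set B := #|_|; move=> <-; rewrite !mul2n -!addnn ltn_add2r => AB.
by rewrite leq_add2l ltnW.
Qed.

(** Cheeger's inequality applies to the parts of [psi] above and below a median,
    as each of them is supported on at most half of the vertices; their energies
    add up to at most the energy of [psi]. *)
Lemma poincare psi : V -> exists m,
  k ^+ 2 * \sum_x (psi x - m) ^+ 2 <= D * energy psi psi.
Proof.
move=> z; have D0 : 0 <= D by apply: le_trans (degree_le z); exact: sumr_ge0.
have [m [mp mn]] := median_exists psi z; exists m.
pose p x := Num.max (psi x - m) 0; pose q x := Num.max (m - psi x) 0.
have /cheeger : forall x, 0 <= p x by move=> x; rewrite le_max lexx orbT.
have -> : supp p = [set x | (m < psi x)%R]%SET.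
  by apply/setP => x; rewrite !inE lt_max ltxx orbF subr_gt0.
move=> /(_ mp) Hp.
have /cheeger : forall x, 0 <= q x by move=> x; rewrite le_max lexx orbT.
have -> : supp q = [set x | (psi x < m)%R]%SET.
  by apply/setP => x; rewrite !inE lt_max ltxx orbF subr_gt0.
move=> /(_ mn) Hq.
have -> : \sum_x (psi x - m) ^+ 2 = \sum_x p x ^+ 2 + \sum_x q x ^+ 2.
  rewrite -big_split; apply: eq_bigr => x _ /=; rewrite /p /q.
  by case: (leP (psi x - m) 0); case: (leP (m - psi x) 0); nra.
have pq : energy p p + energy q q <= energy psi psi.
  rewrite -big_split; apply: ler_sum => x _ /=; rewrite -big_split; apply: ler_sum => y _ /=.
  rewrite -mulrDr ler_wpM2l// /p /q.
  by case: (leP (psi x - m) 0); case: (leP (m - psi x) 0);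
     case: (leP (psi y - m) 0); case: (leP (m - psi y) 0); nra.
rewrite mulrDr; apply: le_trans (lerD Hp Hq) _.
by rewrite -mulrDr ler_wpM2l.
Qed.

(** The energy of a unit current is twice its potential drop [r], whereas by the
    Poincare inequality it is at least of order [r ^+ 2]. *)
Lemma potential_drop_upper u v psi : u != v ->
  (forall x, \sum_y c x y * (psi x - psi y) = (x == u)%:R - (x == v)%:R) ->
  psi u - psi v <= 4 * D / k ^+ 2.
Proof.
move=> uv flow; have [m] := poincare psi u.
rewrite (energy_unit_current flow) => H.
have D0 : 0 <= D by apply: le_trans (degree_le u); exact: sumr_ge0.
set r := psi u - psi v in H *.
have r0 : 0 <= r by exact: potential_drop_ge0 flow.
have k2 : 0 < k ^+ 2 by rewrite exprn_gt0.
rewrite ler_pdivlMr//; have [->|r_neq0] := eqVneq r 0; first by rewrite mul0r mulr_ge0.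
have {r_neq0}r_gt0 : 0 < r by rewrite lt_def r_neq0.
rewrite -(ler_pM2l r_gt0).
suff : r ^+ 2 <= 2 * \sum_x (psi x - m) ^+ 2.
  by move=> /(ler_wpM2l (ltW k2)); rewrite /r in H *; nra.
rewrite (bigD1 u)//= (bigD1 v)/=; last by rewrite eq_sym.
set s := \sum_(_ | _) _; have s0 : 0 <= s by apply: sumr_ge0 => x _; exact: sqr_ge0.
have := sqr_ge0 (psi u + psi v - 2 * m); rewrite /r; nra.
Qed.
End Cheeger.
End Network.

(** * The overlap in an expander *)

Section Resistance.
Context {R : realFieldType} {n : nat}.
Variable w : edge n -> R.
Hypothesis w_gt0 : forall e, 0 < w e.
Hypothesis w_le1 : forall e, w e <= 1.
Variables (D k : R).
Hypothesis k_gt0 : 0 < k.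
Hypothesis degree_le : forall x, degree w x <= D.
Hypothesis expansion : forall S : {set 'I_n},
  (2 * #|S| <= n)%N -> k * #|S|%:R <= cut (conductance w) S.

Lemma edge_prob_bounds e :
  2 / (D + 1) * w e <= edge_prob w e <= 4 * D / k ^+ 2 * w e.
Proof.
have [u [v euv]] := edge_joins e.
have [psi [psi_v -> flow]] := edge_prob_potential w_gt0 euv.
have uv := joins_neq euv; have c0 := conductance_ge0 w_gt0.
have cC := conductanceC w.
have c1 x y : conductance w x y <= 1.
  have [->|/joins_exists[f fxy]] := eqVneq x y.
    rewrite /conductance big_pred0// => f; apply/negbTE/negP => /joins_neq.
    by rewrite eqxx.
  by rewrite (conductanceE w fxy).
rewrite ![_ * w e]mulrC !ler_pM2l// -[psi u]subr0 -psi_v.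
rewrite (potential_drop_lower cC c0 uv flow degree_le c1).
apply: (potential_drop_upper cC c0 k_gt0 degree_le _ uv flow) => S.
by rewrite card_ord => /expansion.
Qed.

Lemma degree_bound_ge0 : (0 < n)%N -> 0 <= D.
Proof.
move=> n0; apply: le_trans (degree_le (Ordinal n0)).
by apply: sumr_ge0 => y _; exact: conductance_ge0.
Qed.

(** The lower bounds on the edge probabilities are nearly exact on average, since
    these probabilities sum to [n - 1]; the excess is then paid for with the
    cruder uniform upper bound. *)
Lemma sum_edge_prob_sqr_bounds l : (0 < n)%N -> l = 2 / (D + 1) ->
  l ^+ 2 * (\sum_e w e ^+ 2) <= \sum_e edge_prob w e ^+ 2 <=
  (4 * D / k ^+ 2 + l) * (n.-1%:R - l * \sum_e w e) + l ^+ 2 * (\sum_e w e ^+ 2).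
Proof.
move=> n0 lE; have D0 := degree_bound_ge0 n0.
have l0 : 0 <= l by rewrite lE divr_ge0// addr_ge0.
rewrite -(sum_edge_prob w_gt0 n0) [l * \sum_e _]mulr_sumr -sumrB !mulr_sumr -big_split.
apply/andP; split; apply: ler_sum => e _ /=.
  have /andP[+ _] := edge_prob_bounds e; rewrite -lE -exprMn => le; rewrite ler_pXn2r ?nnegrE//.
    by rewrite mulr_ge0// ltW.
  by apply: le_trans le; rewrite mulr_ge0// ltW.
have /andP[le ue] := edge_prob_bounds e.
have U0 : 0 <= 4 * D / k ^+ 2 by rewrite divr_ge0 ?mulr_ge0// ltW// exprn_gt0.
move: le ue; rewrite -lE; set U := 4 * D / k ^+ 2 in U0 *; set p := edge_prob w e => le ue.
have := w_gt0 e; have := w_le1 e; set x := w e in le ue * => x1 x0.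
have pU : p <= U by apply: le_trans ue _; rewrite ler_piMr.
have d0 : 0 <= p - l * x by rewrite subr_ge0.
have -> : p ^+ 2 = p * (p - l * x) + l * (x * (p - l * x)) + l ^+ 2 * x ^+ 2 by ring.
rewrite lerD2r mulrDl lerD// ?ler_wpM2r// ler_wpM2l// ler_piMl//.
Qed.

End Resistance.

(** When degrees are at most about [n * m1], the expansion constant is of the same
    order, and the empirical first two moments of the weights are close to [m1]
    and [m2], the two sides of [sum_edge_prob_sqr_bounds] agree to leading
    order. *)
Lemma sum_edge_prob_sqr_estimate {R : realFieldType} {n : nat} (w : edge n -> R)
    (m1 m2 eps : R) :
  (forall e, 0 < w e) -> (forall e, w e <= 1) ->
  0 < m1 -> 0 < m2 -> m1 <= 2 * m2 ->
  0 < eps -> eps <= 8^-1 -> 1 <= eps * n%:R -> 1 <= eps * (n%:R * m1) ->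
  (forall x, degree w x <= (1 + eps) * (n%:R * m1)) ->
  (forall S : {set 'I_n}, (2 * #|S| <= n)%N ->
     n%:R * m1 / 4 * #|S|%:R <= cut (conductance w) S) ->
  forall N f, N = n%:R * (n%:R - 1) / 2 -> f = 2 * m2 / m1 ^+ 2 ->
  (1 - eps) * (N * m1) <= \sum_e w e ->
  (1 - eps) * (N * m2) <= \sum_e w e ^+ 2 <= (1 + eps) * (N * m2) ->
  `|\sum_e edge_prob w e ^+ 2 - f| < 400 * eps * f.
Proof.
move=> w0 w1 m10 m20 m12 e0 e8 en em deg ex N f Ndef fdef W1 /andP[W2l W2u].
have n0 : (0 < n)%N.
  rewrite lt0n; apply: contraTneq en => ->; rewrite mulr0 -ltNge ltr01 //.
set M := n%:R * m1 in em deg ex W1 *.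
have n1 : (1 <= n%:R :> R) by rewrite ler1n.
have nR : 0 < n%:R :> R by rewrite ltr0n.
have M0 : 0 < M by rewrite mulr_gt0.
have k0 : 0 < M / 4 by rewrite divr_gt0.
have := sum_edge_prob_sqr_bounds w0 w1 k0 deg ex n0 erefl.
set l := 2 / _; set U := 4 * _ / _; set O := \sum_e edge_prob w e ^+ 2.
set S1 := \sum_e w e in W1 *; set S2 := \sum_e w e ^+ 2 in W2l W2u *.
move=> /andP[OL OU].
have D1 : 0 < (1 + eps) * M + 1 by rewrite addr_gt0// mulr_gt0// addr_gt0.
have l0 : 0 < l by rewrite divr_gt0.
have lM : l * M <= 2 by rewrite /l mulrAC ler_pdivrMr//; nra.
have lM' : 2 <= l * M * (1 + 2 * eps).
  rewrite /l -mulrA mulrAC ler_pdivlMr//; nra.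
have UM : U * M <= 128.
  have -> : U * M = 64 * (1 + eps) by rewrite /U; field; rewrite lt0r_neq0.
  nra.
have f0 : 0 < f by rewrite fdef divr_gt0 ?mulr_gt0 ?exprn_gt0.
have fm : 1 <= f * m1.
  have -> : f * m1 = 2 * m2 / m1 by rewrite fdef; field; rewrite lt0r_neq0.
  by rewrite ler_pdivlMr ?mul1r.
have N0 : 0 <= N by rewrite Ndef divr_ge0// mulr_ge0// ?subr_ge0// ltW.
have NE : N * m1 = (n%:R - 1) * M / 2 by rewrite Ndef /M; field.
(* [l * w e] bounds the probability of [e] from below, and these bounds already
   account for all but a fraction [3 * eps] of the total [n - 1] *)
have ex1 : n.-1%:R - l * S1 <= 3 * eps * n%:R.
  have -> : n.-1%:R = n%:R - 1 :> R by rewrite -{2}(prednK n0) -natr1 addrK.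
  have H1 : l * ((1 - eps) * (N * m1)) <= l * S1 by rewrite ler_pM2l.
  have H2 : (n%:R - 1) * (1 - 3 * eps) <= l * ((1 - eps) * (N * m1)).
    have -> : l * ((1 - eps) * (N * m1)) = (n%:R - 1) * ((1 - eps) * (l * M / 2)).
      by rewrite NE; field.
    rewrite ler_wpM2l ?subr_ge0//.
    have : (1 - 2 * eps) <= l * M / 2 by nra.
    nra.
  nra.
have ex2 : (U + l) * (n.-1%:R - l * S1) <= 390 * eps * f.
  have Ul : (U + l) * M <= 130 by rewrite mulrDl; lra.
  have Ul0 : 0 <= U + l.
    apply: addr_ge0; last exact: ltW.
    by rewrite ltW// divr_gt0 ?exprn_gt0 ?mulr_gt0// addr_gt0.
  apply: le_trans (ler_wpM2l Ul0 ex1) _.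
  rewrite -(ler_pM2r m10).
  have -> : (U + l) * (3 * eps * n%:R) * m1 = 3 * eps * ((U + l) * M) by rewrite /M; ring.
  nra.
have S2u : l ^+ 2 * S2 <= (1 + eps) * f.
  have H : l ^+ 2 * S2 <= l ^+ 2 * ((1 + eps) * (N * m2)) by rewrite ler_pM2l// exprn_gt0.
  apply: le_trans H _.
  have -> : l ^+ 2 * ((1 + eps) * (N * m2)) =
      (1 + eps) * (f * (((l * M / 2) ^+ 2) * (1 - n%:R^-1))).
    by rewrite Ndef fdef /M; field; rewrite !lt0r_neq0.
  rewrite ler_pM2l ?addr_gt0// -[leRHS]mulr1 ler_pM2l//.
  have ni : 0 <= n%:R^-1 :> R by rewrite invr_ge0 ltW.
  have ni1 : n%:R^-1 <= 1 :> R by rewrite invf_le1.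
  by apply: mulr_ile1; [exact: sqr_ge0 | lra | apply: exprn_ile1; nra | lra].
have S2l : (1 - 8 * eps) * f <= l ^+ 2 * S2.
  have H : l ^+ 2 * ((1 - eps) * (N * m2)) <= l ^+ 2 * S2 by rewrite ler_pM2l// exprn_gt0.
  apply: le_trans H.
  have -> : l ^+ 2 * ((1 - eps) * (N * m2)) =
      ((1 - eps) * (((l * M / 2) ^+ 2) * (1 - n%:R^-1))) * f.
    by rewrite Ndef fdef /M; field; rewrite !lt0r_neq0.
  rewrite ler_pM2r//.
  have ni : n%:R^-1 <= eps by rewrite -[_^-1]mul1r ler_pdivrMr.
  have a1 : (1 - 2 * eps) <= l * M / 2 by nra.
  have a2 : (1 - 4 * eps) <= (l * M / 2) ^+ 2 by nra.
  have a3 : (1 - eps) <= 1 - n%:R^-1 by lra.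
  have a4 : (1 - 4 * eps) * (1 - eps) <= (l * M / 2) ^+ 2 * (1 - n%:R^-1).
    by apply: ler_pM => //; lra.
  nra.
rewrite ltr_norml; apply/andP; split; nra.
Qed.

(** * Independence *)

Section Independence.
Context d (Omega : measurableType d) (R : realType) (P : probability Omega R).
Context (I : finType) (X : I -> {RV P >-> R}).
Hypothesis X_indep : mutually_independent X.
Implicit Types (i j : I) (J : {set I}).

(** A pi-system that generates the sigma-algebra of the variables in [J]. *)
Definition cylinders J : set (set Omega) :=
  [set \bigcap_(i in [set` J]) (X i @^-1` B i) | B in
    [set B : I -> set R | forall i, measurable (B i)]].

Lemma cylinders_setI_closed J : setI_closed (cylinders J).
Proof.
move=> _ _ [B mB <-] [C mC <-]; exists (fun i => B i `&` C i).
  by move=> i; exact: measurableI.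
by rewrite -bigcapI.
Qed.

Lemma cylinders_measurable J S : <<s cylinders J >> S -> measurable S.
Proof.
move: S; apply: smallest_sub => [|_ [B mB <-]]; first exact: sigma_algebra_measurable.
apply: fin_bigcap_measurable => // i _.
by rewrite -[_ @^-1` _]setTI; exact: measurable_funP.
Qed.

Lemma preimage_measurable i (A : set R) : measurable A -> measurable (X i @^-1` A).
Proof. by move=> mA; rewrite -[_ @^-1` _]setTI; exact: measurable_funP. Qed.

(** Dynkin's argument: the product rule extends from cylinders to the
    sigma-algebra that they generate. *)
Lemma cylinders_indep i J (A : set R) (S : set Omega) : i \notin J -> measurable A ->
  <<s cylinders J >> S -> P (X i @^-1` A `&` S) = (P (X i @^-1` A) * P S)%E.
Proof.
move=> iJ mA.
have mXA := preimage_measurable i mA.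
have HC (T : set Omega) : measurable T ->
    P (X i @^-1` A `&` T) = (P (X i @^-1` A) * P T)%E ->
    P (X i @^-1` A `&` ~` T) = (P (X i @^-1` A) * P (~` T))%E.
  move=> mT IH; transitivity (P (X i @^-1` A) - P (X i @^-1` A) * P T)%E.
    rewrite -IH -setDE; apply: measureD => //.
    by rewrite (le_lt_trans (probability_le1 _ _))// ltry.
  rewrite probability_setC// muleBr ?mule1// ?fin_num_measure//.
have HU (F : (set Omega)^nat) : (forall m, measurable (F m)) -> trivIset setT F ->
    (forall m, P (X i @^-1` A `&` F m) = (P (X i @^-1` A) * P (F m))%E) ->
    P (X i @^-1` A `&` \bigcup_m F m) = (P (X i @^-1` A) * P (\bigcup_m F m))%E.
  move=> mF tF IH.
  rewrite setI_bigcupr measure_bigcup//=; last 2 first.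
  - by move=> m _; exact: measurableI.
  - exact: trivIset_setIl.
  rewrite measure_bigcup// -[P (X i @^-1` A)]fineK ?fin_num_measure//.
  rewrite -nneseriesZl//; apply: eq_eseriesr => m _.
  by rewrite IH -[P (X i @^-1` A)]fineK ?fin_num_measure.
have ind := @dynkin_induction _ (g_sigma_algebraType (cylinders J)) (cylinders J)
  (fun S => P (X i @^-1` A `&` S) = (P (X i @^-1` A) * P S)%E).
apply: ind => //.
- exact: cylinders_setI_closed.
- by rewrite setIT probability_setT mule1.
- move=> _ [B mB <-].
  pose B' j := if j == i then A else B j.
  have mB' j : measurable (B' j) by rewrite /B'; case: ifP.
  have B'J j : j \in J -> B' j = B j.
    by rewrite /B' => jJ; case: eqVneq => // ji; rewrite -ji jJ in iJ.
  rewrite (_ : \bigcap_(_ in _) _ = \bigcap_(j in [set` J]) (X j @^-1` B' j)); last first.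
    by apply: eq_bigcapr => j /= jJ; rewrite B'J.
  have B'i : B' i = A by rewrite /B' eqxx.
  rewrite (X_indep J mB') -B'i -(big_setU1 _ iJ) -(X_indep _ mB').
  congr (P _); apply/seteqP; split=> [t [ti tJ] j|t tJ].
    by move=> /=; rewrite !inE => /orP[/eqP ->//|]; exact: tJ.
  by split=> [|j jJ]; apply: tJ; rewrite /= !inE ?eqxx// (jJ : j \in J) orbT.
- by move=> T mT; apply: HC; exact: cylinders_measurable mT.
- by move=> F mF tF; apply: HU => // m; exact: cylinders_measurable (mF m).
Qed.

Lemma measurable_cylinders J i (g : R -> R) : i \in J -> measurable_fun setT g ->
  measurable_fun [set: g_sigma_algebraType (cylinders J)] (fun t => g (X i t)).
Proof.
move=> iJ mg _ B mB; rewrite setTI.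
apply: sub_sigma_algebra; exists (fun j => if j == i then g @^-1` B else setT).
  by move=> j; case: ifP => // _; rewrite -[_ @^-1` _]setTI; exact: mg.
apply/seteqP; split=> t /= => [/(_ i iJ)|H j _]; first by rewrite /= eqxx.
by case: (eqVneq j i) => [->|].
Qed.

Lemma measurable_of_cylinders J (C : Omega -> R) :
  measurable_fun [set: g_sigma_algebraType (cylinders J)] (C : _ -> R) ->
  measurable_fun [set: Omega] C.
Proof.
move=> mC _ B mB; rewrite setTI; apply: (@cylinders_measurable J).
by have := mC measurableT B mB; rewrite setTI.
Qed.

(** The joint law of [X i] and of a function of the other variables is a product
    measure, so that [X i] can be averaged out first. *)
Lemma integral_indep i J (C : Omega -> R) (q : (R * R)%type -> \bar R) : i \notin J ->
  measurable_fun [set: g_sigma_algebraType (cylinders J)] (C : _ -> R) ->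
  measurable_fun [set: (R * R)%type] q -> (forall z, 0 <= q z)%E ->
  (\int[P]_t q (C t, X i t) = \int[P]_t \int[P]_s q (C t, X i s))%E.
Proof.
move=> iJ mC mq q0; have mC' := measurable_of_cylinders mC.
pose Y : {RV P >-> R} := HB.pack C (isMeasurableFun.Build _ _ _ _ C mC').
have mCX : measurable_fun setT (fun t => (Y t, X i t)).
  exact: measurable_fun_pair.
transitivity (\int[distribution P Y]_c \int[distribution P (X i)]_u q (c, u))%E; last first.
  rewrite ge0_integral_distribution//; last 2 first.
  - exact: (measurable_fun_fubini_tonelli_F (m2 := distribution P (X i)) q mq).
  - by move=> c; exact: integral_ge0.
  apply: eq_integral => t _; rewrite /= ge0_integral_distribution//.
  by apply: measurableT_comp mq _; exact: measurable_pair1.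
have <- := fubini_tonelli1 (m1 := distribution P Y) (m2 := distribution P (X i)) q mq q0.
rewrite -[LHS](@ge0_integral_pushforward _ _ _ _ _ _ mCX P setT q)//.
apply: eq_measure_integral => A mA _; apply/esym.
apply: (product_measure_unique (m' := pushforward P (fun t => (Y t, X i t)))) => // B1 B2 mB1 mB2.
rewrite /pushforward muleC -(cylinders_indep iJ mB2) 1?setIC//.
by rewrite -[_ @^-1` _]setTI; exact: mC.
Qed.

Lemma integral_prod_indep J (g : I -> R -> R) :
  (forall i, measurable_fun setT (g i)) -> (forall i x, 0 <= g i x) ->
  (\int[P]_t (\prod_(i in J) g i (X i t))%:E =
   \prod_(i in J) \int[P]_t (g i (X i t))%:E)%E.
Proof.
move=> mg g0; move: {2}#|J| (leqnn #|J|) => m; elim: m J => [|m IH] J.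
  rewrite leqn0 cards_eq0 => /eqP ->; rewrite big_set0.
  under eq_integral do rewrite big_set0.
  by rewrite integral_cst//; exact: etrans (mul1e _) (probability_setT P).
have [->|/finset.set0Pn[i iJ]] := eqVneq J finset.set0.
  by move=> _; apply: IH; rewrite cards0.
rewrite (cardsD1 i) iJ ltnS => /IH {}IH; rewrite (big_setD1 i iJ)/= -IH.
pose C t := \prod_(j in J :\ i) g j (X j t).
have C0 t : 0 <= C t by apply: prodr_ge0.
have mC : measurable_fun [set: g_sigma_algebraType (cylinders (J :\ i))] (C : _ -> R).
  rewrite /C; under eq_fun do rewrite -big_enum.
  apply: measurable_prod => j; rewrite mem_enum => jJ.
  exact: measurable_cylinders.
pose q (z : R * R) := (g i z.2 * `|z.1|)%:E.
have mq : measurable_fun [set: (R * R)%type] q.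
  apply/measurable_EFinP; apply: measurable_funM.
    exact: measurableT_comp (mg i) measurable_snd.
  exact: measurableT_comp (@normr_measurable R setT) measurable_fst.
rewrite (eq_integral (fun t => q (C t, X i t))); last first.
  by move=> t _; rewrite (big_setD1 i iJ) /q /= ger0_norm.
have q0 z : (0 <= q z)%E by rewrite lee_fin mulr_ge0.
have iJ' : i \notin J :\ i by rewrite !inE eqxx.
rewrite (integral_indep iJ' mC mq q0).
have mgX : measurable_fun setT (EFin \o (fun t => g i (X i t))).
  by apply/measurable_EFinP; apply: measurableT_comp (mg i) _; exact: measurable_funP.
rewrite (eq_integral (fun t => (\int[P]_s (g i (X i s))%:E * (C t)%:E)%E)); last first.
  move=> t _; rewrite /q /= -ge0_integralZr//; last by rewrite lee_fin C0.
  - by apply: eq_integral => s _; rewrite EFinM ger0_norm.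
  - by move=> s _; rewrite lee_fin.
rewrite ge0_integralZl//; last by apply: integral_ge0 => s _; rewrite lee_fin.
- by apply/measurable_EFinP; exact: measurable_of_cylinders mC.
- by move=> s _; rewrite lee_fin C0.
Qed.

End Independence.

(** * Chernoff bounds *)

(** From [expR (x / 2) <= (1 - x / 2)^-1], squared; the constant [3 / 8] is below
    the smaller root of [1 - 3 * x + x ^+ 2]. *)
Lemma expR_le_quadratic (R : realType) (x : R) : x <= 3 / 8 -> expR x <= 1 + x + x ^+ 2.
Proof.
move=> x38; have y0 : 0 < 1 - x / 2 by lra.
have hE : expR (x / 2) <= (1 - x / 2)^-1.
  rewrite -[x / 2 in leLHS]opprK expRN lef_pV2 ?posrE ?expR_gt0//.
  by have := expR_ge1Dx (- (x / 2)).
have -> : x = x / 2 + x / 2 by field.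
rewrite expRD; apply: le_trans (ler_pM _ _ hE hE) _; try exact: expR_ge0.
have -> : x / 2 + x / 2 = x by field.
rewrite -invfM -[X in X <= _]mul1r ler_pdivrMr ?mulr_gt0//.
have := sqr_ge0 x; have : 0 <= 1 - 3 * x + x ^+ 2 by nra.
nra.
Qed.

Section Markov.
Context d (Omega : measurableType d) (R : realType) (P : probability Omega R).

Lemma markov_ge0 (f : Omega -> R) (c : R) : measurable_fun setT f ->
  (forall t, 0 <= f t) -> 0 < c ->
  (P [set t | c <= f t]%R <= (c^-1)%:E * \int[P]_t (f t)%:E)%E.
Proof.
move=> mf f0 c0; pose A := [set t | c <= f t].
have mA : measurable A.
  have := mf measurableT _ (measurable_itv `[c, +oo[); rewrite setTI.
  by congr measurable; apply/seteqP; split=> t /=; rewrite in_itv /= andbT.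
rewrite -lee_pdivrMl ?invr_gt0// invrK.
have <- : (\int[P]_(t in A) (cst c%:E t) = c%:E * P A)%E by exact: integral_cst.
apply: le_trans (_ : _ <= \int[P]_(t in A) (f t)%:E)%E _.
  apply: ge0_le_integral => //.
  - by move=> t _; rewrite lee_fin ltW.
  - by apply/measurable_EFinP; exact: measurable_funTS.
apply: ge0_subset_integral => //; first exact/measurable_EFinP.
by move=> t _; rewrite lee_fin.
Qed.

End Markov.

Section Chernoff.
Context d (Omega : measurableType d) (R : realType) (P : probability Omega R).
Context (I : finType) (X : I -> {RV P >-> R}).
Hypothesis X_indep : mutually_independent X.
Variables (Y : I -> R -> R) (m : R).
Hypothesis mY : forall i, measurable_fun setT (Y i).
Hypothesis Y01 : forall i t, 0 <= Y i (X i t) <= 1.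
Hypothesis Y_mean : forall i, (\int[P]_t (Y i (X i t))%:E = m%:E)%E.
Implicit Types (J : {set I}).

Lemma measurable_comp_var i (g : R -> R) : measurable_fun setT g ->
  measurable_fun setT (fun t => g (X i t)).
Proof. by move=> mg; apply: measurableT_comp mg _; exact: measurable_funP. Qed.

Lemma measurable_sum_var J : measurable_fun setT (fun t => \sum_(i in J) Y i (X i t)).
Proof.
under eq_fun do rewrite -big_enum; apply: measurable_sum => i.
exact: measurable_comp_var.
Qed.

Lemma mgf_le i t : t <= 3 / 8 ->
  (\int[P]_s (expR (t * Y i (X i s)))%:E <= (expR (m * (t + t ^+ 2)))%:E)%E.
Proof.
move=> t38; have mYi := measurable_comp_var i (mY i).
apply: le_trans (_ : _ <= (1 + m * (t + t ^+ 2))%:E)%E _; last first.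
  by rewrite lee_fin expR_ge1Dx.
have q s : expR (t * Y i (X i s)) <= 1 + Y i (X i s) * (t + t ^+ 2).
  have /andP[y0 y1] := Y01 i s; set y := Y i _ in y0 y1 *.
  have ty : t * y <= 3 / 8 by nra.
  apply: le_trans (expR_le_quadratic ty) _.
  have : 0 <= t ^+ 2 * (y * (1 - y)) by rewrite mulr_ge0 ?sqr_ge0// mulr_ge0// subr_ge0.
  nra.
apply: le_trans (_ : _ <= \int[P]_s (1 + Y i (X i s) * (t + t ^+ 2))%:E)%E _.
  have mE : measurable_fun setT (fun s => (expR (t * Y i (X i s)))%:E).
    apply/measurable_EFinP; apply: measurableT_comp => //; exact: measurable_funM.
  have mL : measurable_fun setT (fun s => (1 + Y i (X i s) * (t + t ^+ 2))%:E).
    by apply/measurable_EFinP; apply: measurable_funD => //; exact: measurable_funM.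
  by apply: ge0_le_integral => // s _; rewrite lee_fin ?expR_ge0.
have iY : P.-integrable setT (fun s => (Y i (X i s))%:E).
  apply/integrableP; split; first exact/measurable_EFinP.
  rewrite (eq_integral (fun s => (Y i (X i s))%:E)) ?Y_mean ?ltry// => s _.
  by rewrite gee0_abs// lee_fin; have /andP[] := Y01 i s.
under eq_integral do rewrite EFinD EFinM.
rewrite integralD//; last 2 first.
- by apply: finite_measure_integrable_cst.
- by apply: integrableZr.
rewrite integralZr// Y_mean [(1 + _)%:E]EFinD [(m * _)%:E]EFinM leeD2r//.
by rewrite integral_cst// mul1e probability_le1.
Qed.

(** The exponential Markov inequality, for either sign of [t] at once. *)
Lemma chernoff_sum J t a : t <= 3 / 8 ->
  (P [set s | t * a <= t * \sum_(i in J) Y i (X i s)]%R <=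
   (expR (#|J|%:R * m * (t + t ^+ 2) - t * a))%:E)%E.
Proof.
move=> t38; pose g i x := expR (t * Y i x).
have mg i : measurable_fun setT (g i) by apply: measurableT_comp => //; exact: measurable_funM.
have -> : [set s | t * a <= t * \sum_(i in J) Y i (X i s)] =
    [set s | expR (t * a) <= \prod_(i in J) g i (X i s)].
  by apply/seteqP; split=> s /=; rewrite -expR_sum -mulr_sumr ler_expR.
have mf : measurable_fun setT (fun s => \prod_(i in J) g i (X i s)).
  under eq_fun do rewrite -big_enum; apply: measurable_prod => i _.
  exact: measurable_comp_var.
have f0 s : 0 <= \prod_(i in J) g i (X i s) by apply: prodr_ge0 => i _; exact: expR_ge0.
apply: le_trans (markov_ge0 P mf f0 (expR_gt0 (t * a))) _.
rewrite integral_prod_indep//; last by move=> *; exact: expR_ge0.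
rewrite addrC expRD expRN EFinM lee_wpmul2l ?lee_fin ?invr_ge0 ?expR_ge0//.
apply: le_trans (_ : _ <= \prod_(i in J) (expR (m * (t + t ^+ 2)))%:E)%E _.
  suff /andP[] : (0 <= \prod_(i in J) \int[P]_s (g i (X i s))%:E <=
      \prod_(i in J) (expR (m * (t + t ^+ 2)))%:E)%E by [].
  elim/big_ind2 : _ => [|x1 x2 y1 y2 /andP[x0 x12] /andP[y0 y12]|i _].
  - by rewrite lexx lee01.
  - by rewrite mule_ge0// lee_pmul.
  - rewrite mgf_le// andbT; apply: integral_ge0 => s _.
    by rewrite lee_fin expR_ge0.
rewrite -(big_morph EFin (@EFinM R) erefl) lee_fin prodr_const -expRM_natl.
by rewrite mulrA.
Qed.

(** Here [A] need only bound the mean of the sum, on the appropriate side; the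
    exponent comes from [t = e / 2]. *)
Lemma chernoff_upper J A e : 0 < e -> e <= 3 / 4 -> #|J|%:R * m <= A ->
  (P [set s | (1 + e) * A <= \sum_(i in J) Y i (X i s)]%R <=
   (expR (- (A * e ^+ 2 / 4)))%:E)%E.
Proof.
move=> e0 e1 mA; have t0 : 0 < e / 2 by rewrite divr_gt0.
have -> : [set s | (1 + e) * A <= \sum_(i in J) Y i (X i s)] =
    [set s | e / 2 * ((1 + e) * A) <= e / 2 * \sum_(i in J) Y i (X i s)].
  by apply/seteqP; split=> s /=; rewrite ler_pM2l.
apply: le_trans (chernoff_sum J _ _) _; first lra.
rewrite lee_fin ler_expR.
have : #|J|%:R * m * (e / 2 + (e / 2) ^+ 2) <= A * (e / 2 + (e / 2) ^+ 2).
  by rewrite ler_wpM2r// addr_ge0 ?sqr_ge0// ltW.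
have -> : e / 2 * ((1 + e) * A) = A * (e / 2 + e ^+ 2 / 2) by field.
have -> : (e / 2) ^+ 2 = e ^+ 2 / 4 by field.
nra.
Qed.

Lemma chernoff_lower J A e : 0 < e -> e <= 3 / 4 -> A <= #|J|%:R * m ->
  (P [set s | \sum_(i in J) Y i (X i s) <= (1 - e) * A]%R <=
   (expR (- (A * e ^+ 2 / 4)))%:E)%E.
Proof.
move=> e0 e1 mA; have t0 : 0 < e / 2 by rewrite divr_gt0.
have -> : [set s | \sum_(i in J) Y i (X i s) <= (1 - e) * A] =
    [set s | - (e / 2) * ((1 - e) * A) <= - (e / 2) * \sum_(i in J) Y i (X i s)].
  by apply/seteqP; split=> s /=; rewrite ler_nM2l ?oppr_lt0.
apply: le_trans (chernoff_sum J _ _) _; first lra.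
rewrite lee_fin ler_expR.
have H : e / 2 - e ^+ 2 / 4 >= 0 by nra.
have : A * (e / 2 - e ^+ 2 / 4) <= #|J|%:R * m * (e / 2 - e ^+ 2 / 4).
  by rewrite ler_wpM2r.
have -> : - (e / 2) * ((1 - e) * A) = - (A * (e / 2 - e ^+ 2 / 2)) by field.
have -> : (- (e / 2)) ^+ 2 = e ^+ 2 / 4 by field.
nra.
Qed.

End Chernoff.

(** * Averages over a uniform variable *)

Section Uniform.
Context d (Omega : measurableType d) (R : realType) (P : probability Omega R).
Variable U : {RV P >-> R}.
Hypothesis U_uniform : forall B : set R, measurable B ->
  distribution P U B = uniform_prob (@ltr01 R) B.

Lemma integral_uniform_var (g : R -> R) : measurable_fun setT g -> (forall x, 0 <= g x) ->
  (\int[P]_t (g (U t))%:E = \int[lebesgue_measure]_(x in `[0%R, 1%R]) (g x)%:E)%E.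
Proof.
move=> mg g0.
have mg' : measurable_fun [set: measurableTypeR R] (EFin \o g).
  by apply/measurable_EFinP; exact: mg.
have g0' x : (0 <= (EFin \o g) x)%E by rewrite lee_fin.
have mU : measurable_fun setT (U : Omega -> measurableTypeR R) 
  by move=> mD B mB; have := measurable_funP U; apply.
pose V : {mfun Omega >-> measurableTypeR R} :=
  HB.pack (U : Omega -> measurableTypeR R) (isMeasurableFun.Build _ _ _ _ _ mU).
have := ge0_integral_distribution (P := P) V mg' g0' => /= <-.
transitivity (\int[uniform_prob (@ltr01 R)]_x (g x)%:E)%E.
  by apply: eq_measure_integral => A mA _; exact: U_uniform.
rewrite (integral_uniform (@ltr01 R) (f := EFin \o g))//.
by rewrite subr0 invr1 mul1e.
Qed.

Lemma integral_uniform_FTC (g f F : R -> R) : measurable_fun setT g ->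
  (forall x, 0 <= g x) -> (forall x, x \in `[0, 1] -> g x = f x) ->
  (forall x : R, {for x, continuous f}) -> (forall x : R, is_derive x (1 : R) F (f x)) ->
  (\int[P]_t (g (U t))%:E = (F 1 - F 0)%:E)%E.
Proof.
move=> mg g0 gf cf dF; rewrite integral_uniform_var//.
transitivity (\int[lebesgue_measure]_(x in `[0%R, 1%R]) (f x)%:E)%E.
  by apply: eq_integral => x; rewrite inE => x01; rewrite gf.
have cF x : {for x, continuous F}.
  apply: differentiable_continuous; apply/derivable1_diffP.
  by have [] := dF x.
rewrite (@continuous_FTC2 _ f F)//.
- by apply: continuous_subspaceT => x; exact: cf.
- split=> [x _||].
  + by have [] := dF x.
  + by apply: cvg_at_right_filter; exact: cF.
  + by apply: cvg_at_left_filter; exact: cF.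
- by move=> x _; rewrite derive1E; apply: derive_val.
Qed.

(** The weight [expR (- (b * x))], truncated so as to be at most [1] for every
    real [x]; the truncation is inactive on the unit interval. *)
Definition capped_weight (b x : R) : R := Num.min (expR (- (b * x))) 1.

Lemma measurable_capped_weight b : measurable_fun setT (capped_weight b).
Proof.
apply: measurable_minr => //; apply: measurableT_comp => //.
by apply: measurableT_comp => //; exact: measurable_funM.
Qed.

Lemma capped_weight01 b x : 0 <= capped_weight b x <= 1.
Proof. by rewrite le_min expR_ge0 ler01 ge_min lexx orbT. Qed.

Lemma capped_weightE b x : 0 <= b -> 0 <= x -> capped_weight b x = expR (- (b * x)).
Proof.
by move=> b0 x0; rewrite /capped_weight min_l// -expR0 ler_expR oppr_le0 mulr_ge0.
Qed.

Lemma integral_capped_weight b : 0 < b ->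
  (\int[P]_t (capped_weight b (U t))%:E = ((1 - expR (- b)) / b)%:E)%E.
Proof.
move=> b0.
have dF (x : R) : is_derive x (1 : R) (fun x => - (expR (- (b * x)) / b)) (expR (- (b * x))).
  apply: is_derive_eq.
  rewrite /GRing.scale/=; field; exact: lt0r_neq0.
have cf (x : R) : {for x, continuous (fun x => expR (- (b * x)))}.
  apply: continuous_comp; last exact: continuous_expR.
  apply: continuousN; apply: continuousM; [exact: cst_continuous | exact: cvg_id].
rewrite (integral_uniform_FTC (measurable_capped_weight b) _ _ cf dF).
- by rewrite mulr1 mulr0 oppr0 expR0; congr EFin; field; rewrite lt0r_neq0.
- by move=> x; have /andP[] := capped_weight01 b x.
- by move=> x; rewrite in_itv/= => /andP[x0 _]; rewrite capped_weightE// ltW.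
Qed.

(** Averaging [p (1 - p)] over one weight, for [p] the conditional probability
    [z / (z + c)]: as [p] is logistic in [x], its derivative is [- b p (1 - p)]. *)
Lemma integral_logistic b c : 0 < b -> 0 <= c ->
  (\int[P]_t (expR (- (b * U t)) * c / (expR (- (b * U t)) + c) ^+ 2)%:E <= (b^-1)%:E)%E.
Proof.
move=> b0 c0; have e0 x : 0 < expR (- (b * x)) + c by rewrite ltr_wpDr ?expR_gt0.
pose p x := expR (- (b * x)) / (expR (- (b * x)) + c).
have cE (x : R) : {for x, continuous (fun x => expR (- (b * x)))}.
  apply: continuous_comp; last exact: continuous_expR.
  apply: continuousN; apply: continuousM; [exact: cst_continuous | exact: cvg_id].
pose f x := expR (- (b * x)) * c / (expR (- (b * x)) + c) ^+ 2.
have cf (x : R) : {for x, continuous f}.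
  apply: continuousM; first by apply: continuousM (cE x) _; exact: cst_continuous.
  apply: continuousV; first by rewrite lt0r_neq0// exprn_gt0.
  rewrite /continuous_at; apply: cvgM.
    by apply: cvgD; [exact: cE | exact: cvg_cst].
  by apply: cvgD; [exact: cE | exact: cvg_cst].
have dF (x : R) : is_derive x (1 : R) (fun x => - (p x / b)) (f x).
  have n0 : expR (- (b * x)) + c != 0 by rewrite lt0r_neq0.
  apply: is_derive_eq.
  rewrite /GRing.scale/= /f; field; rewrite n0; exact: lt0r_neq0.
rewrite (integral_uniform_FTC (g := f) _ _ _ cf dF)//.
- have p1 : 0 <= p 1 by rewrite divr_ge0 ?expR_ge0// ltW.
  have p0 : p 0 <= 1.
    by rewrite ler_pdivrMr// mul1r lerDl.
  have bi : 0 <= b^-1 by rewrite invr_ge0 ltW.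
  by rewrite lee_fin; nra.
- exact: continuous_measurable_fun.
- by move=> x; rewrite divr_ge0 ?sqr_ge0// mulr_ge0 ?expR_ge0.
Qed.

End Uniform.

(** * Measurability and convergence in probability *)

Lemma measurable_fun_div (d : measure_display) (T : measurableType d) (R : realType)
    (f g : T -> R) : measurable_fun setT f -> measurable_fun setT g ->
  (forall t, 0 < g t) -> measurable_fun setT (fun t => f t / g t).
Proof.
move=> mf mg g0; apply: measurable_funM => //.
rewrite [X in measurable_fun _ X](_ : _ = fun t => expR (- ln (g t))).
  apply: measurableT_comp => //; apply: measurableT_comp => //.
  exact: measurableT_comp.
by apply/funext => t; rewrite expRN lnK// posrE.
Qed.

Section MeasurableTrees.
Context d (T : measurableType d) (R : realType) (n : nat) (w : T -> edge n -> R).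
Hypothesis w_gt0 : forall t e, 0 < w t e.
Hypothesis mw : forall e, measurable_fun setT (fun t => w t e).

Lemma measurable_tree_weight A : measurable_fun setT (fun t => tree_weight (w t) A).
Proof.
rewrite /tree_weight; under eq_fun do rewrite -big_enum.
by apply: measurable_prod => e _; exact: mw.
Qed.

Lemma measurable_edge_prob e : measurable_fun setT (fun t => edge_prob (w t) e).
Proof.
apply: measurable_fun_div => [||t].
- under eq_fun do rewrite -big_filter.
  by apply: measurable_sum => A; exact: measurable_tree_weight.
- rewrite /tree_sum; under eq_fun do rewrite -big_filter.
  by apply: measurable_sum => A; exact: measurable_tree_weight.
- by apply: tree_sum_gt0.
Qed.

End MeasurableTrees.

Lemma eq_tree_weight (R : realFieldType) (n : nat) (w w' : edge n -> R) (A : {set edge n}) :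
  {in A, w =1 w'} -> tree_weight w A = tree_weight w' A.
Proof. by move=> ww'; apply: eq_bigr => e eA; exact: ww'. Qed.

(** Convergence in probability along every admissible sequence provides common
    error functions: at [(b, n)], take the best error among [1 / (k + 1)] for
    [k <= n], which depends on the sequence only through its value at [n]. *)
Lemma whp_asymptotic_of_eventually (R : realType) (d : nat -> measure_display)
    (Omega : forall n, measurableType (d n))
    (P : forall n, probability (Omega n) R)
    (growth : (nat -> R) -> Prop)
    (X : forall n, R -> Omega n -> R) (f : nat -> R -> R) :
  (forall n b, measurable_fun setT (X n b)) ->
  (forall beta, growth beta -> forall eps : R, 0 < eps -> \forall n \near \oo,
    (P n [set w | (eps * f n (beta n) <= `|X n (beta n) w - f n (beta n)|)%R]
       <= eps%:E)%E) ->
  whp_asymptotic P growth X f.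
Proof.
move=> mX ev.
pose good b n k := `[< (P n [set w | (k.+1%:R^-1 * f n b <= `|X n b w - f n b|)%R]
       <= (k.+1%:R^-1)%:E)%E >].
have good0 b n : good b n 0%N.
  apply/asboolP; rewrite invr1 probability_le1//.
  have -> : [set w | (1 * f n b <= `|X n b w - f n b|)%R] =
      (fun w => `|X n b w - f n b|) @^-1` `[f n b, +oo[.
    by apply/seteqP; split=> w /=; rewrite in_itv/= andbT mul1r.
  rewrite -[_ @^-1` _]setTI; apply: measurableT_comp => //.
  exact: measurable_funB.
pose K b n := [arg max_(k > (ord0 : 'I_n.+1) | good b n k) (k : nat)]%O.
have goodK b n : good b n (K b n) by rewrite /K; case: arg_maxP => //; exact: good0.
have maxK b n k : (k <= n)%N -> good b n k -> (k <= K b n)%N.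
  move=> kn gk; rewrite /K; case: arg_maxP => [|i gi maxi]; first exact: good0.
  by have := maxi (Ordinal (kn : (k < n.+1)%N)) gk.
pose h b n : R := (nat_of_ord (K b n)).+1%:R^-1.
have h0 b n : 0 <= h b n by rewrite invr_ge0.
have ch beta : growth beta -> (fun n => h (beta n) n) @ \oo --> (0 : R).
  move=> gb; apply/cvgr0Pnorm_lt => e e0.
  have [k ke] : exists k, k.+1%:R^-1 < e.
    by have [k _ /(_ k (leqnn k))] := near_infty_natSinv_lt (PosNum e0); exists k.
  have k0 : 0 < k.+1%:R^-1 :> R by rewrite invr_gt0.
  near=> n; rewrite ger0_norm//; apply: le_lt_trans ke.
  rewrite lef_pV2 ?posrE// ler_nat ltnS; apply: maxK.
    by near: n; exact: nbhs_infty_ge.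
  by apply/asboolP; near: n; exact: ev.
exists h, h; split=> // beta gb; split; [exact: ch|exact: ch|].
by move=> n; have /asboolP := goodK (beta n) n.
Unshelve. all: by end_near. Qed.

Section Environment.
Context d (Omega : measurableType d) (R : realType) (P : probability Omega R).
Context (n : nat) (omega : edge n -> {RV P >-> R}).

Lemma measurable_edge_overlap b :
  measurable_fun setT (fun t => edge_overlap b (fun e => omega e t)).
Proof.
under eq_fun do rewrite edge_overlapE.
apply: measurable_sum => e; apply: measurable_funX.
apply: measurable_edge_prob => [t f|f]; first exact: expR_gt0.
apply: measurableT_comp => //; apply: measurableT_comp => //.
by apply: measurable_funM => //; exact: measurable_funP.
Qed.

End Environment.

(** * Low temperature *)

Lemma card_edge n : #|edge n| = 'C(n, 2).
Proof. by rewrite card_sig -[in RHS](card_ord n) -card_draws cardsE. Qed.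

Section LowTemperature.
Context d (Omega : measurableType d) (R : realType) (P : probability Omega R).
Context (n : nat) (omega : edge n -> {RV P >-> R}).
Hypothesis omega_iid : iid_uniform01 omega.
Variable b : R.
Hypothesis b_gt0 : 0 < b.

Let w t : edge n -> R := weight b (fun e => omega e t).

Let w_gt0 t e : 0 < w t e. Proof. exact: expR_gt0. Qed.

Let mw e : measurable_fun setT (fun t => w t e).
Proof.
apply: measurableT_comp => //; apply: measurableT_comp => //.
by apply: measurable_funM => //; exact: measurable_funP.
Qed.

(** Given the other weights, the probability of [e] is [w e / (w e + C)] with [C]
    independent of [omega e]; so [integral_logistic] applies after averaging
    [omega e] out first. *)
Lemma integral_edge_prob_variance e :
  (\int[P]_t (edge_prob (w t) e * (1 - edge_prob (w t) e))%:E <= (b^-1)%:E)%E.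
Proof.
have [/existsP[T0 /andP[tT0 eT0]]|/existsPn noT] :=
  boolP [exists T, tree T && (e \in T)]; last first.
  rewrite integral0_eq ?lee_fin ?invr_ge0 ?ltW// => t _; congr EFin.
  rewrite /edge_prob big_pred0 ?mul0r// => T; exact/negbTE.
(* the weights with that of [e] reset, hence functions of the other variables *)
pose w1 t f := if f == e then 1 else w t f.
have w1_gt0 t f : 0 < w1 t f by rewrite /w1; case: ifP.
pose A t := \sum_(T | tree T && (e \in T)) tree_weight (w1 t) T.
pose B t := \sum_(T | tree T && (e \notin T)) tree_weight (w1 t) T.
pose C t := B t / A t.
have A_gt0 t : 0 < A t.
  rewrite /A (bigD1 T0) ?tT0//=; apply: ltr_pwDl; first exact: tree_weight_gt0.
  by apply: sumr_ge0 => T _; exact/ltW/tree_weight_gt0.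
have C_ge0 t : 0 <= C t.
  apply: divr_ge0; last exact: ltW.
  by apply: sumr_ge0 => T _; exact/ltW/tree_weight_gt0.
have pE t : edge_prob (w t) e = w t e / (w t e + C t).
  have NE : \sum_(T | tree T && (e \in T)) tree_weight (w t) T = w t e * A t.
    rewrite /A mulr_sumr; apply: eq_bigr => T /andP[_ eT].
    have w1e : w1 t e = 1 by rewrite /w1 eqxx.
    rewrite (tree_weightD1 (w t) eT) (tree_weightD1 (w1 t) eT) w1e mul1r; congr (_ * _).
    by apply: eq_tree_weight => f; rewrite !inE /w1 => /andP[/negbTE ->].
  have -> : edge_prob (w t) e = w t e * A t / (w t e * A t + B t).
    rewrite /edge_prob NE; congr (_ / _); rewrite -NE /tree_sum (bigID (fun T : {set edge n} => e \in T))/=.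
    congr (_ + _); apply: eq_bigr => T /andP[_ eT]; apply: eq_tree_weight => f fT.
    by rewrite /w1; case: eqVneq => // fe; rewrite -fe fT in eT.
  have A0 := lt0r_neq0 (A_gt0 t).
  have wC : w t e + C t != 0 by rewrite lt0r_neq0// ltr_wpDr.
  have wB : w t e * A t + B t != 0.
    by have := mulf_neq0 wC A0; rewrite mulrDl /C mulfVK.
  rewrite /C; field; by rewrite A0 wB.
pose q (z : R * R) : \bar R :=
  (expR (- (b * z.2)) * `|z.1| / (expR (- (b * z.2)) + `|z.1|) ^+ 2)%:E.
have -> : (\int[P]_t (edge_prob (w t) e * (1 - edge_prob (w t) e))%:E =
    \int[P]_t q (C t, omega e t))%E.
  apply: eq_integral => t _; rewrite pE /q /= ger0_norm//; congr EFin.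
  have -> : expR (- (b * omega e t)) = w t e by [].
  have wC : w t e + C t != 0 by rewrite lt0r_neq0// ltr_wpDr.
  by field.
have d_gt0 (z : R * R) : 0 < expR (- (b * z.2)) + `|z.1| by rewrite ltr_wpDr// expR_gt0.
have mq : measurable_fun [set: (R * R)%type] q.
  have m2 : measurable_fun [set: (R * R)%type] (fun z => expR (- (b * z.2))).
    apply: measurableT_comp => //; apply: measurableT_comp => //.
    by apply: measurable_funM; [exact: measurable_cst | exact: measurable_snd].
  have m1 : measurable_fun [set: (R * R)%type] (fun z => `|z.1|).
    exact: measurableT_comp (@normr_measurable R setT) measurable_fst.
  apply/measurable_EFinP; apply: measurable_fun_div => [||z]; last by rewrite exprn_gt0.
    exact: measurable_funM.
  by apply: measurable_funX; exact: measurable_funD.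
have q0 z : (0 <= q z)%E.
  by rewrite lee_fin divr_ge0 ?mulr_ge0 ?expR_ge0// exprn_ge0// ltW.
have mw1 f : measurable_fun [set: g_sigma_algebraType (cylinders omega (~: [set e]))]
    (fun t => w1 t f).
  rewrite /w1; case: eqVneq => [_|fe]; first exact: measurable_cst.
  apply: (measurable_cylinders (i := f) (g := fun x => expR (- (b * x)))).
    by rewrite !inE.
  apply: measurableT_comp => //; apply: measurableT_comp => //.
have mC : measurable_fun [set: g_sigma_algebraType (cylinders omega (~: [set e]))] (C : _ -> R).
  apply: (@measurable_fun_div _ (g_sigma_algebraType (cylinders omega (~: [set e]))) R B A) => //.
    rewrite /B; under eq_fun do rewrite -big_filter.
    by apply: measurable_sum => T; exact: measurable_tree_weight.
  rewrite /A; under eq_fun do rewrite -big_filter.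
  by apply: measurable_sum => T; exact: measurable_tree_weight.
have [om_ind om_unif] := omega_iid.
rewrite (integral_indep om_ind _ mC mq q0); last by rewrite !inE eqxx.
have le_b t : (\int[P]_s q (C t, omega e s) <= (b^-1)%:E)%E.
  apply: le_trans (integral_logistic (om_unif e) b_gt0 (C_ge0 t)).
  by rewrite le_eqVlt; apply/orP; left; apply/eqP; apply: eq_integral => s _;
    rewrite /q /= ger0_norm.
apply: le_trans (_ : _ <= \int[P]_t (b^-1)%:E)%E _; last first.
  rewrite integral_cst//; apply: le_trans (lee_wpmul2l _ (probability_le1 _ _)) _ => //.
    by rewrite lee_fin invr_ge0 ltW.
  by rewrite mule1.
have mI : measurable_fun setT (fun t => \int[P]_s q (C t, omega e s))%E.
  rewrite [X in measurable_fun _ X](_ : _ =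
      fubini_F (distribution P (omega e)) q \o C); last first.
    apply/funext => t; rewrite /= /fubini_F ge0_integral_distribution//.
    by apply: measurableT_comp mq _; exact: measurable_pair1.
  apply: measurableT_comp; last exact: measurable_of_cylinders mC.
  exact: (measurable_fun_fubini_tonelli_F (m2 := distribution P (omega e)) q mq).
apply: ge0_le_integral => //; by move=> t _; apply: integral_ge0.
Qed.

Lemma edge_overlap_deficit t : (0 < n)%N ->
  n%:R - edge_overlap b (fun e => omega e t) =
  1 + \sum_e edge_prob (w t) e * (1 - edge_prob (w t) e).
Proof.
move=> n0; rewrite edge_overlapE.
under [in RHS]eq_bigr do rewrite mulrBr mulr1 -expr2.
rewrite sumrB (sum_edge_prob (w_gt0 t) n0) -{1}(prednK n0) -natr1 addrA.
by congr (_ - _); rewrite addrC.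
Qed.

Lemma edge_prob01 t e : 0 <= edge_prob (w t) e <= 1.
Proof.
have Z0 := tree_sum_gt0 (w_gt0 t).
have N0 : 0 <= \sum_(T | tree T && (e \in T)) tree_weight (w t) T.
  by apply: sumr_ge0 => T _; exact/ltW/tree_weight_gt0.
apply/andP; split; first exact: divr_ge0 N0 (ltW Z0).
rewrite ler_pdivrMr// mul1r /tree_sum [leRHS](bigID (fun T : {set edge n} => e \in T))/=.
by rewrite lerDl; apply: sumr_ge0 => T _; exact/ltW/tree_weight_gt0.
Qed.

(** Markov's inequality for the deficit [n - overlap], whose mean is at most
    [1 + 'C(n, 2) / b]. *)
Lemma overlap_low_temperature eps : (0 < n)%N -> 0 < eps ->
  (P [set t | (eps * n%:R <= `|edge_overlap b (fun e => omega e t) - n%:R|)%R]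
   <= ((n%:R^-1 + n%:R / b) / eps)%:E)%E.
Proof.
move=> n0 e0; have nR : 0 < n%:R :> R by rewrite ltr0n.
pose v t e := edge_prob (w t) e * (1 - edge_prob (w t) e).
have v0 t e : 0 <= v t e.
  by have /andP[p0 p1] := edge_prob01 t e; rewrite mulr_ge0// subr_ge0.
have mp e : measurable_fun setT (fun t => edge_prob (w t) e).
  exact: (measurable_edge_prob w_gt0 mw).
have mv e : measurable_fun setT (fun t => v t e).
  by apply: measurable_funM => //; apply: measurable_funB.
pose f t := 1 + \sum_e v t e.
have f0 t : 0 <= f t by rewrite addr_ge0// sumr_ge0.
have mf : measurable_fun setT f.
  by apply: measurable_funD => //; apply: measurable_sum.
have -> : [set t | (eps * n%:R <= `|edge_overlap b (fun e => omega e t) - n%:R|)%R] =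
    [set t | eps * n%:R <= f t].
  by apply/seteqP; split=> t /=; rewrite distrC edge_overlap_deficit// ger0_norm ?f0.
apply: le_trans (markov_ge0 P mf f0 (mulr_gt0 e0 nR)) _.
have -> : (\int[P]_t (f t)%:E = 1 + \sum_e \int[P]_t (v t e)%:E)%E.
  rewrite /f; under eq_integral do rewrite EFinD -sumEFin.
  rewrite ge0_integralD//; last 2 first.
  - by move=> t _; apply: sume_ge0 => e _; rewrite lee_fin.
  - by apply: emeasurable_sum => e; exact/measurable_EFinP.
  rewrite integral_cst// ge0_integral_sum//.
  - by congr (_ + _)%E; exact: etrans (mul1e _) (probability_setT P).
  - by move=> e; exact/measurable_EFinP.
  - by move=> e t _; rewrite lee_fin.
apply: le_trans (_ : _ <= ((eps * n%:R)^-1)%:E * (1 + \sum_(e : edge n) (b^-1)%:E))%E _.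
  apply: lee_wpmul2l; first by rewrite lee_fin invr_ge0 ltW// mulr_gt0.
  rewrite leeD2l//.
  by apply: lee_sum => e _; exact: integral_edge_prob_variance.
rewrite sumEFin -EFinD -EFinM lee_fin sumr_const card_edge.
rewrite -[b^-1 *+ _]mulr_natl.
have cn : ('C(n, 2))%:R <= n%:R ^+ 2 :> R.
  rewrite -natrX ler_nat bin2 -divn2; apply: leq_trans (leq_div _ _) _.
  by rewrite leq_mul2l leq_pred orbT.
have cb : ('C(n, 2))%:R / b <= n%:R ^+ 2 / b by rewrite ler_wpM2r// invr_ge0 ltW.
have -> : (n%:R^-1 + n%:R / b) / eps = (eps * n%:R)^-1 * (1 + n%:R ^+ 2 / b).
  by field; rewrite !lt0r_neq0.
by rewrite ler_wpM2l ?lerD2l// invr_ge0 ltW// mulr_gt0.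
Qed.

End LowTemperature.

(** * Cuts and degrees as sums of independent weights *)

Section Crossing.
Context {R : realFieldType} {n : nat}.
Implicit Types (S : {set 'I_n}) (w : edge n -> R).

Definition crossing S : {set edge n} :=
  [set e | [exists x in S, exists y in ~: S, joins e x y]]%SET.

Lemma crossingE S e u v : joins e u v ->
  (e \in crossing S) = (u \in S) (+) (v \in S).
Proof.
move=> euv; rewrite inE; apply/exists_inP/idP => [[x xS /exists_inP[y]]|].
  rewrite finset.in_setC => yS exy.
  by case: (joins_eq exy euv) => -[-> ->]; rewrite xS (negbTE yS).
case: (boolP (u \in S)) => [uS vS|uS vS].
  by exists u => //; apply/exists_inP; exists v; rewrite ?finset.in_setC.
exists v => //; apply/exists_inP; exists u; rewrite ?finset.in_setC//.
by rewrite joinsC.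
Qed.

Lemma cut_crossing w S : cut (conductance w) S = \sum_(e in crossing S) w e.
Proof.
rewrite cutE sum_conductance [RHS]big_mkcond; apply: eq_bigr => e _.
have [u [v euv]] := edge_joins e.
rewrite (big_joins _ (fun x y => ((x \in S) && (y \notin S))%:R) euv) (crossingE S euv).
by case: (u \in S); case: (v \in S); rewrite /= ?addr0 ?add0r ?mulr0 ?mulr1.
Qed.

Lemma card_crossing S : #|crossing S|%:R = #|S|%:R * (n%:R - #|S|%:R) :> R.
Proof.
have c1 x y : x != y -> conductance (fun=> 1 : R) x y = 1.
  by move=> /joins_exists[e exy]; rewrite (conductanceE _ exy).
have := cut_crossing (fun=> 1) S; rewrite sumr_const => <-.
have -> : n%:R - #|S|%:R = #|~: S|%:R :> R.
  by rewrite -{1}(card_ord n) -(cardsC S) natrD addrC addKr.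
rewrite /cut (eq_bigr (fun=> #|~: S|%:R)) => [|x xS].
  by rewrite sumr_const mulr_natl.
rewrite (eq_bigr (fun=> 1)) ?sumr_const// => y; rewrite finset.in_setC => yS.
by apply: c1; apply: contraNneq yS => <-.
Qed.

Lemma degree_crossing w x : degree w x = \sum_(e in crossing [set x]) w e.
Proof.
have cxx : conductance w x x = 0.
  by rewrite /conductance big_pred0// => e; apply/negbTE/negP => /joins_neq; rewrite eqxx.
rewrite -cut_crossing /cut big_set1 /degree [LHS](bigD1 x)//= cxx add0r.
by apply: eq_bigl => y; rewrite !inE.
Qed.

Lemma card_edgeR : #|edge n|%:R = n%:R * (n%:R - 1) / 2 :> R.
Proof.
rewrite card_edge; case: n => [|m]; first by rewrite bin0n mul0r mul0r.
have := mul_bin_diag m.+1 1; rewrite /= bin1 => /(congr1 (fun k => k%:R : R)).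
rewrite !natrM => E; apply: (canRL (mulfK _)); first by rewrite pnatr_eq0.
by rewrite mulrC -E -natr1 addrK.
Qed.

End Crossing.

Lemma sum_pow_card (R : realFieldType) (n : nat) (q : R) :
  \sum_(S : {set 'I_n}) q ^+ #|S| = (1 + q) ^+ n.
Proof.
rewrite -[in RHS](card_ord n) -prodr_const addrC.
rewrite (eq_bigl xpredT) // (bigA_distr _ _ (fun=> q) (fun=> 1))/=.
by apply: eq_bigr => S _; rewrite -big_mkcond prodr_const.
Qed.

Section UnionBound.
Context d (Omega : measurableType d) (R : realType) (P : probability Omega R).

Lemma measurable_le_fun (f g : Omega -> R) : measurable_fun setT f ->
  measurable_fun setT g -> measurable [set t | f t <= g t].
Proof.
move=> mf mg; have -> : [set t | f t <= g t] = (fun t => f t - g t) @^-1` `]-oo, 0].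
  by apply/seteqP; split=> t /=; rewrite in_itv/= subr_le0.
by rewrite -[_ @^-1` _]setTI; apply: measurable_funB.
Qed.

Lemma union_bound (I : finType) (Q : pred I) (F : I -> set Omega) :
  (forall i, measurable (F i)) ->
  (P (\big[setU/set0]_(i | Q i) F i) <= \sum_(i | Q i) P (F i))%E.
Proof.
move=> mF; elim: (index_enum I) => [|i s IH]; first by rewrite !big_nil measure0.
rewrite !big_cons; case: ifP => // _.
apply: le_trans (measureU2 P _ _) _ => //; last exact: leeD2l.
exact: bigsetU_measurable.
Qed.

End UnionBound.

(** * High temperature *)

Section HighTemperature.
Context d (Omega : measurableType d) (R : realType) (P : probability Omega R).
Context (n : nat) (omega : edge n -> {RV P >-> R}).
Hypothesis omega_iid : iid_uniform01 omega.
Variables b eps : R.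
Hypothesis b_gt0 : 0 < b.
Hypothesis n_ge3 : (3 <= n)%N.
Hypothesis eps_gt0 : 0 < eps.
Hypothesis eps_le : eps <= 8^-1.

Let om_ind : mutually_independent omega := omega_iid.1.
Let m1 : R := (1 - expR (- b)) / b.
Let m2 : R := (1 - expR (- (2 * b))) / (2 * b).
Let M : R := n%:R * m1.
Let N : R := n%:R * (n%:R - 1) / 2.
Let L : R := ln n%:R.

Hypothesis n_large : 1 <= eps * n%:R.
Hypothesis M_large : 1 <= eps * M.
Hypothesis M_log : 2 * L <= M * eps ^+ 2 / 8.

Let Y1 (e : edge n) : R -> R := capped_weight b.
Let Y2 (e : edge n) : R -> R := capped_weight (2 * b).

Let mY1 e : measurable_fun setT (Y1 e). Proof. exact: measurable_capped_weight. Qed.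
Let mY2 e : measurable_fun setT (Y2 e). Proof. exact: measurable_capped_weight. Qed.
Let Y1_01 e t : 0 <= Y1 e (omega e t) <= 1. Proof. exact: capped_weight01. Qed.
Let Y2_01 e t : 0 <= Y2 e (omega e t) <= 1. Proof. exact: capped_weight01. Qed.
Let Y1_mean e : (\int[P]_t (Y1 e (omega e t))%:E = m1%:E)%E.
Proof. exact: (integral_capped_weight (omega_iid.2 e)). Qed.
Let Y2_mean e : (\int[P]_t (Y2 e (omega e t))%:E = m2%:E)%E.
Proof. by apply: (integral_capped_weight (omega_iid.2 e)); rewrite mulr_gt0. Qed.

Let eb_lt1 : expR (- b) < 1. Proof. by rewrite -expR0 ltr_expR oppr_lt0. Qed.
Let eb2 : expR (- (2 * b)) = expR (- b) ^+ 2.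
Proof. by rewrite -expRM_natl mulrN. Qed.

Let m1_gt0 : 0 < m1. Proof. by rewrite divr_gt0// subr_gt0. Qed.
Let m12 : m1 <= 2 * m2.
Proof.
have -> : 2 * m2 = (1 - expR (- (2 * b))) / b by rewrite /m2; field; rewrite lt0r_neq0.
rewrite /m1 ler_wpM2r ?invr_ge0 ?(ltW b_gt0)// eb2.
by have := expR_gt0 (- b); have := eb_lt1; nra.
Qed.
Let m2_gt0 : 0 < m2. Proof. by have := m12; have := m1_gt0; lra. Qed.
Let n_gt0 : 0 < n%:R :> R. Proof. by rewrite ltr0n (leq_trans _ n_ge3). Qed.
Let n_ge3R : 3 <= n%:R :> R. Proof. by rewrite (ler_nat R 3). Qed.
Let M_gt0 : 0 < M. Proof. exact: mulr_gt0. Qed.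
Let N_ge : n%:R <= N. Proof. by rewrite /N; have := n_ge3R; nra. Qed.
Let M_log' : 2 * L <= M / 32.
Proof.
apply: le_trans M_log _; rewrite -mulrA ler_wpM2l ?(ltW M_gt0)//.
by have := eps_le; have := eps_gt0; nra.
Qed.

Let expM_le x : 2 * L <= x -> expR (- x) <= n%:R ^- 2.
Proof.
move=> Lx; apply: le_trans (_ : expR (- (2 * L)) <= _); first by rewrite ler_expR lerN2.
by rewrite expRN expRM_natl lnK// posrE.
Qed.

(** Outside these events the weights satisfy the hypotheses of
    [sum_edge_prob_sqr_estimate]. *)
Let B0 := \big[setU/set0]_(e : edge n) [set t | omega e t < 0].
Let B1 := \big[setU/set0]_(x : 'I_n)
  [set t | (1 + eps) * M <= \sum_(e in crossing [set x]%SET) Y1 e (omega e t)].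
Let B2 := \big[setU/set0]_(S : {set 'I_n} | (S != finset.set0) && (2 * #|S| <= n)%N)
  [set t | \sum_(e in crossing S) Y1 e (omega e t) <= (1 - 2^-1) * (#|S|%:R * M / 2)].
Let B3 := [set t | \sum_(e in [set: edge n]%SET) Y1 e (omega e t) <= (1 - eps) * (N * m1)].
Let B4 := [set t | \sum_(e in [set: edge n]%SET) Y2 e (omega e t) <= (1 - eps) * (N * m2)].
Let B5 := [set t | (1 + eps) * (N * m2) <= \sum_(e in [set: edge n]%SET) Y2 e (omega e t)].

Let msum1 (J : {set edge n}) : measurable_fun setT (fun t => \sum_(e in J) Y1 e (omega e t)).
Proof. exact: measurable_sum_var. Qed.
Let msum2 (J : {set edge n}) : measurable_fun setT (fun t => \sum_(e in J) Y2 e (omega e t)).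
Proof. exact: measurable_sum_var. Qed.

Let card_all : #|[set: edge n]%SET|%:R = N.
Proof. by rewrite cardsT card_edgeR. Qed.

Let n2_le : n%:R ^- 2 <= n%:R^-1 :> R.
Proof. by rewrite lef_pV2 ?posrE ?exprn_gt0// ler_eXnr// ler1n (leq_trans _ n_ge3). Qed.

Let PB0 : P B0 = 0%E.
Proof.
apply/eqP; rewrite eq_le measure_ge0 andbT.
have mB e : measurable [set t | omega e t < 0].
  have -> : [set t | omega e t < 0] = omega e @^-1` `]-oo, 0[.
    by apply/seteqP; split=> t /=; rewrite in_itv.
  exact: preimage_measurable.
apply: le_trans (union_bound P xpredT mB) _; rewrite big1// => e _.
have -> : [set t | omega e t < 0] = omega e @^-1` `]-oo, 0[.
  by apply/seteqP; split=> t /=; rewrite in_itv.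
have -> : P (omega e @^-1` `]-oo, 0[) = distribution P (omega e) `]-oo, 0[ by [].
rewrite (omega_iid.2 e)// /uniform_prob integral_uniform_pdf.
rewrite (_ : _ `&` _ = set0) ?integral_set0//.
by apply/seteqP; split=> x //=; rewrite !in_itv/= => -[x0 /andP[x0' _]]; move: x0; rewrite ltNge x0'.
Qed.

Let PB1 : (P B1 <= (n%:R^-1)%:E)%E.
Proof.
have mB (x : 'I_n) : measurable
    [set t | (1 + eps) * M <= \sum_(e in crossing [set x]%SET) Y1 e (omega e t)].
  exact: measurable_le_fun.
apply: le_trans (union_bound P xpredT mB) _.
apply: le_trans (_ : _ <= \sum_(x : 'I_n) (n%:R ^- 2)%:E)%E _.
  apply: lee_sum => x _.
  have e34 : eps <= 3 / 4 by have := eps_le; lra.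
  apply: le_trans (chernoff_upper om_ind mY1 Y1_01 Y1_mean eps_gt0 e34 _) _.
    by rewrite card_crossing cards1 mul1r /M ler_pM2r ?m1_gt0// gerBl.
  rewrite lee_fin; apply: expM_le; apply: le_trans M_log _.
  by have := mulr_gt0 M_gt0 (exprn_gt0 2 eps_gt0); lra.
rewrite sumEFin lee_fin sumr_const card_ord -[_ *+ n]mulr_natl expr2 invfM mulrA.
by rewrite mulfV ?mul1r// lt0r_neq0.
Qed.

(** The sets [S] with [s] elements contribute at most [(n * q) ^+ s], so that the
    sum is dominated by the singletons. *)
Let PB2 : (P B2 <= (2 / n%:R)%:E)%E.
Proof.
have mB (S : {set 'I_n}) : measurable
    [set t | \sum_(e in crossing S) Y1 e (omega e t) <= (1 - 2^-1) * (#|S|%:R * M / 2)].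
  exact: measurable_le_fun.
apply: le_trans (union_bound P _ mB) _.
pose q := expR (- (M / 32)).
have q0 : 0 <= q by exact: expR_ge0.
have qn : n%:R * q <= n%:R^-1.
  have -> : n%:R^-1 = n%:R * n%:R ^- 2 :> R by field; rewrite lt0r_neq0.
  by rewrite ler_pM2l//; exact: expM_le.
apply: le_trans (_ : _ <= \sum_(S : {set 'I_n} | S != finset.set0) (q ^+ #|S|)%:E)%E _.
  rewrite big_mkcondr; apply: lee_sum => S _; case: ifP => [Sn|_]; last first.
    by rewrite lee_fin exprn_ge0.
  have SnR : 2 * #|S|%:R <= n%:R :> R by rewrite -natrM ler_nat.
  have half0 : 0 < 2^-1 :> R by rewrite invr_gt0.
  have half34 : 2^-1 <= 3 / 4 :> R by lra.
  apply: le_trans (chernoff_lower om_ind mY1 Y1_01 Y1_mean half0 half34 _) _.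
    rewrite card_crossing /M.
    have : 0 <= #|S|%:R * m1 by rewrite mulr_ge0// ltW.
    nra.
  rewrite lee_fin /q -expRM_natl ler_expR.
  have -> : #|S|%:R * M / 2 * 2^-1 ^+ 2 / 4 = #|S|%:R * (M / 32) by field.
  by rewrite mulrN.
have := sum_pow_card n q; rewrite (bigD1 finset.set0)//= cards0 expr0 => E.
rewrite sumEFin lee_fin.
have -> : \sum_(S : {set 'I_n} | S != finset.set0) q ^+ #|S| = (1 + q) ^+ n - 1.
  by rewrite -E addrAC subrr add0r.
have : (1 + q) ^+ n <= expR (n%:R * q).
  by rewrite expRM_natl; apply: lerXn2r; rewrite ?nnegrE ?addr_ge0 ?expR_ge0 ?expR_ge1Dx.
have n3 : n%:R^-1 <= 3^-1 :> R by rewrite lef_pV2 ?posrE.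
have nq0 : 0 <= n%:R * q by rewrite mulr_ge0// ltW.
have : expR (n%:R * q) <= 1 + n%:R * q + (n%:R * q) ^+ 2.
  by apply: expR_le_quadratic; lra.
nra.
Qed.

Let PB345 : [/\ (P B3 <= (n%:R^-1)%:E)%E, (P B4 <= (n%:R^-1)%:E)%E & (P B5 <= (n%:R^-1)%:E)%E].
Proof.
have e34 : eps <= 3 / 4 by have := eps_le; lra.
have N0 : 0 <= N by apply: le_trans N_ge; exact: ltW.
have A1 : 0 <= N * m1 by rewrite mulr_ge0// ltW.
have A2 : 0 <= N * m2 by rewrite mulr_ge0// ltW.
have MN : M <= N * m1 by rewrite ler_pM2r.
have MN2 : M / 2 <= N * m2 by have := m12; have := N0; nra.
have e2 : 0 < eps ^+ 2 by rewrite exprn_gt0.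
split.
- apply: le_trans (chernoff_lower om_ind mY1 Y1_01 Y1_mean eps_gt0 e34 _) _.
    by rewrite card_all.
  rewrite lee_fin; apply: le_trans n2_le; apply: expM_le; apply: le_trans M_log _; nra.
- apply: le_trans (chernoff_lower om_ind mY2 Y2_01 Y2_mean eps_gt0 e34 _) _.
    by rewrite card_all.
  rewrite lee_fin; apply: le_trans n2_le; apply: expM_le; apply: le_trans M_log _; nra.
- apply: le_trans (chernoff_upper om_ind mY2 Y2_01 Y2_mean eps_gt0 e34 _) _.
    by rewrite card_all.
  rewrite lee_fin; apply: le_trans n2_le; apply: expM_le; apply: le_trans M_log _; nra.
Qed.

Lemma overlap_high_temperature f : f = 2 * m2 / m1 ^+ 2 ->
  (P [set t | (400 * eps * f <= `|edge_overlap b (fun e => omega e t) - f|)%R]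
   <= (6 / n%:R)%:E)%E.
Proof.
move=> fE; set D := [set t | _].
have mD : measurable D.
  apply: measurable_le_fun => //; apply: measurableT_comp => //.
  by apply: measurable_funB => //; exact: measurable_edge_overlap.
have mBs : [/\ measurable B0, measurable B1, measurable B2 &
    [/\ measurable B3, measurable B4 & measurable B5]].
  split; last by split; exact: measurable_le_fun.
  - apply: bigsetU_measurable => e _.
    have -> : [set t | omega e t < 0] = omega e @^-1` `]-oo, 0[.
      by apply/seteqP; split=> t /=; rewrite in_itv.
    exact: preimage_measurable.
  - by apply: bigsetU_measurable => x _; exact: measurable_le_fun.
  - by apply: bigsetU_measurable => S _; exact: measurable_le_fun.
have [mB0 mB1 mB2 [mB3 mB4 mB5]] := mBs.
pose B := B0 `|` (B1 `|` (B2 `|` (B3 `|` (B4 `|` B5)))).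
have DB : D `<=` B.
  move=> t Dt; apply: contrapT => nB.
  have [n0 [n1 [n2 [n3 [n4 n5]]]]] :
      ~ B0 t /\ ~ B1 t /\ ~ B2 t /\ ~ B3 t /\ ~ B4 t /\ ~ B5 t.
    by do 5 (split; first by (move=> Bt; apply: nB; rewrite /B /=; tauto));
       move=> Bt; apply: nB; rewrite /B /=; tauto.
  pose w := weight b (fun e => omega e t).
  have w0 e : 0 < w e by exact: expR_gt0.
  have om0 e : 0 <= omega e t.
    rewrite leNgt; apply/negP => om; apply: n0; rewrite /B0 (bigD1 e)//=; by left.
  have wY1 e : w e = Y1 e (omega e t) by rewrite /Y1 capped_weightE// ltW.
  have wY2 e : w e ^+ 2 = Y2 e (omega e t).
    by rewrite /Y2 capped_weightE// ?mulr_ge0 ?(ltW b_gt0)// /w /weight -expRM_natl mulrN mulrA.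
  have w1 e : w e <= 1 by rewrite wY1; have /andP[] := Y1_01 e t.
  have sumw J : \sum_(e in J) w e = \sum_(e in J) Y1 e (omega e t).
    by apply: eq_bigr => e _; exact: wY1.
  have sumw2 : \sum_e w e ^+ 2 = \sum_(e in [set: edge n]%SET) Y2 e (omega e t).
    by apply: eq_big => e; [rewrite inE | move=> _; exact: wY2].
  have : `|\sum_e edge_prob w e ^+ 2 - f| < 400 * eps * f.
    apply: (sum_edge_prob_sqr_estimate w0 w1 m1_gt0 m2_gt0 m12 eps_gt0 eps_le
      n_large M_large _ _ (N := N) erefl fE).
    - move=> x; rewrite degree_crossing sumw leNgt; apply/negP => H; apply: n1.
      by rewrite /B1 (bigD1 x)//=; left; exact: ltW.
    - move=> S SV; have [->|S0] := eqVneq S finset.set0.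
        by rewrite cards0 mulr0 /cut big_set0.
      rewrite cut_crossing sumw leNgt; apply/negP => H; apply: n2.
      rewrite /B2 (bigD1 S)/=; last by rewrite S0.
      left => /=; apply: le_trans (ltW H) _; rewrite le_eqVlt; apply/orP; left.
      by apply/eqP; rewrite /M; field.
    - have -> : \sum_e w e = \sum_(e in [set: edge n]%SET) Y1 e (omega e t).
        by rewrite -sumw; apply: eq_bigl => e; rewrite inE.
      by rewrite leNgt; apply/negP => H; apply: n3; exact: ltW.
    - rewrite sumw2; apply/andP; split; rewrite leNgt; apply/negP => H.
        by apply: n4; exact: ltW.
      by apply: n5; exact: ltW.
  by rewrite ltNge; move: Dt; rewrite /D /= edge_overlapE => ->.
have mB : measurable B by do 5 (apply: measurableU => //).
apply: le_trans (le_measure P _ _ DB) _; rewrite ?inE//.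
have [P3 P4 P5] := PB345.
have -> : 6 / n%:R = 0 + (n%:R^-1 + (2 / n%:R + (n%:R^-1 + (n%:R^-1 + n%:R^-1)))) :> R.
  by field; rewrite lt0r_neq0.
have P0 : (P B0 <= 0%:E)%E by rewrite PB0.
rewrite !EFinD.
do 4 (apply: le_trans (measureU2 P _ _) _; [by []|by do ?[apply: measurableU => //]|];
  apply: leeD => //).
by apply: le_trans (measureU2 P _ _) _ => //; exact: leeD.
Qed.

End HighTemperature.

(** * Growth conditions *)

Section Growth.
Context {R : realType}.

Lemma ln_le_linear (c : R) : 0 < c -> \forall n \near \oo, ln n%:R <= c * n%:R.
Proof.
move=> c0; near=> n.
have n0 : 0 < n%:R :> R by rewrite ltr0n; near: n; exact: nbhs_infty_gt.
have n4 : 4 / c ^+ 2 <= n%:R by near: n; exact: nbhs_infty_ger.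
rewrite -ler_expR lnK ?posrE//.
have cn : 0 < c * n%:R by rewrite mulr_gt0.
have -> : c * n%:R = c * n%:R / 2 + c * n%:R / 2 by field.
have E := expR_ge1Dx (c * n%:R / 2).
rewrite expRD; apply: le_trans (ler_pM _ _ E E); try by lra.
move: n4; rewrite ler_pdivrMr ?exprn_gt0// => n4.
have : 4 * n%:R <= n%:R * c ^+ 2 * n%:R by rewrite ler_pM2r.
nra.
Unshelve. all: by end_near. Qed.

Lemma ln_ge_16th n : (3 <= n)%N -> 16^-1 <= ln (n%:R : R).
Proof.
move=> n3; have n3R : 3 <= n%:R :> R by rewrite (ler_nat R 3).
rewrite -ler_expR lnK ?posrE; last by lra.
by apply: le_trans (expR_le_quadratic _) _; lra.
Qed.

Lemma one_minus_expR_ge (b : R) : 0 < b -> (1 + b)^-1 <= (1 - expR (- b)) / b.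
Proof.
move=> b0; have b1 : 0 < 1 + b by rewrite addr_gt0.
rewrite ler_pdivlMr//.
have : expR (- b) <= (1 + b)^-1.
  by rewrite expRN lef_pV2 ?posrE ?expR_gt0// expR_ge1Dx.
have -> : (1 + b)^-1 * b = 1 - (1 + b)^-1 by field; rewrite lt0r_neq0.
lra.
Qed.

End Growth.

(** * The edge overlap at high and at low temperature *)

Unset Implicit Arguments.

Theorem theorem1p1 (R : realType) (d : nat -> measure_display)
    (Omega : forall n : nat, measurableType (d n))
    (P : forall n : nat, probability (Omega n) R)
    (omega : forall n : nat, edge n -> {RV (P n) >-> R})
    (omega_iid : forall n : nat, iid_uniform01 (omega n)) :
  whp_asymptotic P
    (fun beta : nat -> R =>
       (forall n : nat, 0 < beta n) /\
       much_less beta (fun n : nat => n%:R / ln n%:R))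
    (fun (n : nat) (b : R) (w : Omega n) =>
       edge_overlap b (fun e : edge n => omega n e w))
    (fun (n : nat) (b : R) =>
       b * ((1 - expR (- (2 * b))) / (1 - expR (- b)) ^+ 2))
  /\
  whp_asymptotic P
    (fun beta : nat -> R =>
       (forall n : nat, 0 <= beta n) /\
       much_less (fun n : nat => n%:R * ln n%:R ^+ 2) beta)
    (fun (n : nat) (b : R) (w : Omega n) =>
       edge_overlap b (fun e : edge n => omega n e w))
    (fun (n : nat) (b : R) => n%:R).
Proof.
split; apply: whp_asymptotic_of_eventually.
- by move=> n b; exact: measurable_edge_overlap.
- move=> beta [beta_gt0 [_ beta_small]] del del0.
  pose eps := Num.min 8^-1 (del / 400).
  have eps0 : 0 < eps by rewrite lt_min invr_gt0 divr_gt0 ?ltr0n.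
  have eps8 : eps <= 8^-1 by rewrite ge_min lexx.
  have epsd : 400 * eps <= del.
    by rewrite mulrC -ler_pdivlMr ?ltr0n// ge_min lexx orbT.
  (* chosen so that [(1 + beta) * ln n <= c * n] yields the logarithmic bound on
     the mean degree in [overlap_high_temperature] *)
  pose c := eps ^+ 2 / 16.
  have c0 : 0 < c by rewrite divr_gt0 ?exprn_gt0.
  near=> n.
  have n3 : (3 <= n)%N by near: n; exact: nbhs_infty_ge.
  have n0 : 0 < n%:R :> R by rewrite ltr0n (leq_trans _ n3).
  have b0 := beta_gt0 n; set b := beta n in b0 *.
  have L16 := @ln_ge_16th R n n3; set L := ln n%:R in L16 *.
  have ne : eps^-1 <= n%:R by near: n; exact: nbhs_infty_ger.
  have nd : 6 / del <= n%:R by near: n; exact: nbhs_infty_ger.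
  have Ln : L <= c / 2 * n%:R.
    by rewrite /L; near: n; apply: ln_le_linear; rewrite divr_gt0.
  have bL : b * L <= c / 2 * n%:R.
    have : `|b / (n%:R / L)| < c / 2.
      rewrite /b /L; near: n; move: beta_small => /cvgr0Pnorm_lt; apply.
      by rewrite divr_gt0.
    rewrite invf_div => /ltW /(le_trans (ler_norm _)).
    by rewrite mulrA ler_pdivrMr.
  set m1 := (1 - expR (- b)) / b.
  have m1b : (1 + b)^-1 <= m1 by exact: one_minus_expR_ge.
  have b1 : 0 < 1 + b by rewrite addr_gt0.
  have LM : L <= c * (n%:R * m1).
    have : L <= c * n%:R / (1 + b) by rewrite ler_pdivlMr//; lra.
    move/le_trans; apply; rewrite -mulrA ler_wpM2l ?(ltW c0)//.
    by rewrite ler_pM2l.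
  have Me : 2 * L <= n%:R * m1 * eps ^+ 2 / 8 by move: LM; rewrite /c; lra.
  have M0 : 0 < n%:R * m1 by rewrite -(pmulr_rgt0 _ c0); lra.
  have ne' : 1 <= eps * n%:R by rewrite mulrC -ler_pdivrMr// mul1r.
  have Me' : 1 <= eps * (n%:R * m1) by nra.
  have eb1 : expR (- b) < 1 by rewrite -expR0 ltr_expR oppr_lt0.
  pose f := b * ((1 - expR (- (2 * b))) / (1 - expR (- b)) ^+ 2).
  have fE : f = 2 * ((1 - expR (- (2 * b))) / (2 * b)) / m1 ^+ 2.
    by rewrite /f /m1; field; rewrite !lt0r_neq0// subr_gt0.
  have f0 : 0 <= f.
    rewrite mulr_ge0 ?(ltW b0)// divr_ge0 ?sqr_ge0// subr_ge0.
    by rewrite -expR0 ler_expR oppr_le0 mulr_ge0 ?(ltW b0).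
  have mX : measurable_fun setT (fun w => edge_overlap b (fun e => omega n e w)).
    exact: measurable_edge_overlap.
  have mD (h : R) : measurable
      [set w | h * f <= `|edge_overlap b (fun e => omega n e w) - f|].
    apply: measurable_le_fun => //; apply: measurableT_comp => //.
    exact: measurable_funB.
  have := overlap_high_temperature (omega_iid n) b0 n3 eps0 eps8 ne' Me' Me fE.
  move=> H; apply: le_trans (le_trans H _); last first.
    by rewrite lee_fin ler_pdivrMr// mulrC -ler_pdivrMr.
  apply: le_measure; rewrite ?inE//.
  by move=> w /=; apply: le_trans; rewrite ler_wpM2r.
- by move=> n b; exact: measurable_edge_overlap.
- move=> beta [beta_ge0 [beta_neq0 beta_large]] eps eps0.
  have e2 : 0 < eps ^+ 2 / 2 by rewrite divr_gt0 ?exprn_gt0.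
  near=> n.
  have n3 : (3 <= n)%N by near: n; exact: nbhs_infty_ge.
  have n0 : 0 < n%:R :> R by rewrite ltr0n (leq_trans _ n3).
  have b0 : 0 < beta n by rewrite lt_def beta_ge0 andbT; near: n.
  have n_ge1 : (0 < n)%N by exact: leq_trans n3.
  apply: le_trans (overlap_low_temperature (omega_iid n) b0 n_ge1 eps0) _.
  rewrite lee_fin ler_pdivrMr// -expr2.
  have n_inv : n%:R^-1 <= eps ^+ 2 / 2.
    rewrite -[leRHS]invrK lef_pV2 ?posrE ?invr_gt0//.
    by near: n; exact: nbhs_infty_ger.
  have L16 := @ln_ge_16th R n n3.
  have H : `|n%:R * ln n%:R ^+ 2 / beta n| < eps ^+ 2 / 2 / 16 ^+ 2.
    near: n; move: beta_large => /cvgr0Pnorm_lt; apply.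
    exact: divr_gt0 e2 (exprn_gt0 2 (ltr0Sn R 15)).
  have ln16 : 1 <= (16 * ln n%:R) ^+ 2 :> R.
    by rewrite exprn_ege1// -ler_pdivrMl// mulr1.
  have nb : n%:R / beta n <= eps ^+ 2 / 2.
    have nb0 : 0 <= n%:R / beta n by rewrite divr_ge0 ?(ltW n0) ?(ltW b0).
    apply: le_trans (ler_peMr nb0 ln16) _.
    rewrite exprMn mulrCA mulrC -ler_pdivlMr ?exprn_gt0//.
    by rewrite mulrAC; exact: le_trans (ler_norm _) (ltW H).
  by rewrite [leRHS]splitr lerD.
Unshelve. all: by end_near. Qed.
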